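(* For every positive integer $n$ there exists $\epsilon > 0$ such that the following holds. Let $C$ be any $n \times n$ positive semidefinite matrix with $\operatorname{tr}(C) = n$ whose vector of eigenvalues $\boldsymbol{c} = (c_1,\ldots,c_n)$ satisfies $\|\boldsymbol{c} - \boldsymbol{1}\|_1 < \epsilon$. Then over the set of all $n$-tuples $(X_1,\ldots,X_n)$ of $n \times n$ positive semidefinite matrices with $\operatorname{tr}(X_i) = 1$ for all $i$ and $\sum_{i=1}^n X_i = C$, the mixed discriminant $\mathrm{MD}(X_1,\ldots,X_n)$ is uniquely minimized at $(X_1,\ldots,X_n) = \left(\frac{1}{n}C,\ldots,\frac{1}{n}C\right)$.
   Context: Positive semidefinite (PSD) matrices are complex Hermitian positive semidefinite matrices. $\boldsymbol{1}$ is the all-ones vector in $\mathbb{R}^n$ and $\|\boldsymbol{x}\|_1 = \sum_{i=1}^n |x_i|$. The mixed discriminant of an $n$-tuple of $n \times n$ matrices is $\mathrm{MD}(X_1,\ldots,X_n) = \frac{1}{n!}\, \partial_{t_1} \cdots \partial_{t_n} \det(t_1 X_1 + \cdots + t_n X_n)$. *)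

(* Defs.v *)
From mathcomp Require Import all_boot all_order all_algebra.
From mathcomp Require Import complex mpoly reals.

Set Implicit Arguments.
Unset Strict Implicit.
Unset Printing Implicit Defensive.

Import Order.TTheory GRing.Theory Num.Theory.
Local Open Scope ring_scope.
Local Open Scope sesquilinear_scope.
Local Open Scope complex_scope.

Section Defs.

Variables (R : realType) (n : nat).

Definition psdmx (A : 'M[R[i]]_n) : Prop :=
  A \is hermsymmx /\ forall v : 'cV[R[i]]_n, 0 <= (v ^t* *m A *m v) 0 0.

(* [c] lists the eigenvalues of [A] with algebraic multiplicity; the order of
   the listing is irrelevant wherever this is used. *)
Definition eigenvalue_vector (A : 'M[R[i]]_n) (c : 'rV[R]_n) : Prop :=
  char_poly A = \prod_(i < n) ('X - ((c 0 i)%:C)%:P).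

Definition norm1 (x : 'rV[R]_n) : R := \sum_(i < n) `|x 0 i|.

Definition det_pencil (X : 'I_n -> 'M[R[i]]_n) : {mpoly R[i][n]} :=
  \det (\sum_(i < n) 'X_i *: map_mx (@mpolyC n R[i]) (X i)).

(* The polynomial [det_pencil X] is homogeneous of degree n, so its derivative
   in all n variables is a constant polynomial; [_@_0] reads off the constant. *)
Definition mixed_discr (X : 'I_n -> 'M[R[i]]_n) : R[i] :=
  (n`!%:R)^-1 * ((det_pencil X)^`M[[multinom 1%N | _ < n]])@_0.

Definition feasible (A : 'M[R[i]]_n) (X : 'I_n -> 'M[R[i]]_n) : Prop :=
  [/\ forall i, psdmx (X i), forall i, \tr (X i) = 1 & \sum_(i < n) X i = A].

(* The order on [R[i]] is the partial one: [x <= y] means that [y - x] is a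
   nonnegative real.  Tuples are compared entrywise. *)
Definition uniquely_minimized_at (I T : Type) (S : (I -> T) -> Prop)
    (f : (I -> T) -> R[i]) (X0 : I -> T) : Prop :=
  [/\ S X0, forall X, S X -> f X0 <= f X
    & forall X, S X -> f X = f X0 -> X =1 X0].

End Defs.

(* Main.v *)
From mathcomp Require Import all_boot all_order all_algebra fingroup perm.
From mathcomp Require Import complex reals ring lra.
From mathcomp Require mpoly all_classical all_reals all_analysis.
Require Import Defs.
Set Implicit Arguments.
Unset Strict Implicit.
Unset Printing Implicit Defensive.
Import Order.TTheory GRing.Theory Num.Theory.
Local Open Scope ring_scope.
Local Open Scope sesquilinear_scope.

(** Up to the factor n!, the mixed discriminant is the polarized determinant
    [pdet]: symmetric, linear in each of its n slots, and equal to n! det A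
    when every slot holds A.  Two facts of different nature give the theorem.

    The first is global and concerns C = 1 only: among tuples of positive
    semidefinite matrices of trace 1 with sum 1, [pdet] is at least n!/n^n,
    with equality only at the constant tuple (Bapat's conjecture, a theorem of
    Gurvits).  The proof is Gurvits's capacity argument.  Put
    A = sum_(i in S) t_i X_i in the slots of S and leave X_i in the others; call
    the value [pfill X S A].  For S the whole index set it is
    n! det (sum_i t_i X_i), at least n! prod_i t_i ([capacity]); for S empty it
    is the quantity of interest.  To let an index k leave S, consider
    p(s) = pfill X S (A + s X_k), of degree d = #|S|, whose derivative at 0 is d
    times the next value.  For definite matrices all its roots are negative
    ([pfill_pencil_root]): the determinant does not vanish on matrices with
    positive definite Hermitian part, and this property is inherited by
    derivatives in the manner of Gauss-Lucas ([pfill_accretive_neq0]).  The AM-GM inequality on the roots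
    bounds p above by the d-th power of an affine function with the same first
    two coefficients ([pfill_tangent]); in this form the information survives
    the passage to the limit from definite to semidefinite matrices.  A lower
    bound p(s) >= c s for all s > 0 then forces p'(0) >= c ((d-1)/d)^(d-1)
    ([capacity_step]), and these losses multiply up to n!/n^n
    ([pdet_lower_bound]).  When n!/n^n is reached, the optimal s is reached in
    every step, so one can climb back to the whole index set and find t with
    det (sum_i t_i X_i) = prod_i t_i and equality in AM-GM; the latter makes X_k
    a multiple of sum_i t_i X_i, the former then makes that matrix scalar
    ([extremal_unique]).

    The second fact is local.  Replacing X_i and X_j by their average adds to
    [pdet] its value with D = (X_i - X_j)/2 in the slots i and j.  If the other
    slots are 1, this value is -(n-2)! tr (D^2), as tr D = 0; hence it is
    negative for D <> 0 as long as the other slots stay within a fixed distance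
    of 1/n ([near_scalar_pair_negative]).

    Compactness joins the two ([near_of_small_pdet]): if det (sum_i X_i) is
    close enough to 1 and X does at least as well as the constant tuple with
    the same sum, then all X_i are within that distance of 1/n.  So in a
    minimizer with sum C, which exists by compactness again, no two entries
    can differ. *)

(** * The polarized determinant *)

(** n! times the mixed discriminant: det (sum_i t_i X_i) is multilinear in the
    columns, and these are the terms of its expansion in which every X_i
    supplies one column. *)
Definition pdet (K : comNzRingType) (n : nat) (X : 'I_n -> 'M[K]_n) : K :=
  \sum_(s : 'S_n) \det (\matrix_(i, j) X (s j) i j).

Section MixedDiscriminant.
Import mpoly.

(** Differentiating once in each variable reads off the coefficient of the
    squarefree monomial. Expand the determinant of the pencil over all maps f
    that choose a matrix for each index: f contributes to this coefficient
    only if it is a bijection. *)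
Lemma mixed_discrE (R : realType) (n : nat) (X : 'I_n -> 'M[R[i]]_n) :
  mixed_discr X = n`!%:R^-1 * pdet X.
Proof.
rewrite /mixed_discr; congr (_ * _).
have detE : det_pencil X = \sum_(t : 'S_n) \sum_(f : {ffun 'I_n -> 'I_n})
    ((-1) ^+ t * \prod_j X (f j) j (t j)) *: 'X_[(\sum_(j < n) U_(f j))%MM].
  rewrite /det_pencil /determinant; apply: eq_bigr => t _.
  have -> : \prod_i (\sum_(i0 < n) 'X_i0 *: map_mx (@mpolyC n R[i]) (X i0)) i (t i)
      = \prod_i \sum_(k < n) X k i (t i) *: 'X_k.
    apply: eq_bigr => i _; rewrite summxE; apply: eq_bigr => k _.
    by rewrite !mxE mulrC mul_mpolyC.
  rewrite bigA_distr_bigA big_distrr /=; apply: eq_bigr => f _.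
  have -> : \prod_(i < n) (X (f i) i (t i) *: 'X_(f i)) =
    (\prod_(i < n) X (f i) i (t i)) *: 'X_[(\sum_(j < n) U_(f j))%MM] :> {mpoly R[i][n]}.
    rewrite -mul_mpolyC -mprodXE rmorph_prod /= -big_split /=.
    by apply: eq_bigr => i _; rewrite mul_mpolyC.
  by rewrite -scalerA; case: (odd_perm t);
    rewrite /= ?expr1 ?expr0 ?mul1r ?scale1r ?mulN1r ?scaleN1r.
rewrite mcoeff_mderivm addm0 [X in _ *+ X]big1 ?mulr1n; last first.
  by move=> i _; rewrite mnmE ffactn1.
rewrite detE raddf_sum /= /pdet.
have sumE (f : {ffun 'I_n -> 'I_n}) :
  ((\sum_(j < n) U_(f j))%MM == [multinom 1%N | _ < n]) = injectiveb f.
  have cE i : (\sum_(j < n) U_(f j))%MM i = #|[pred j | f j == i]|.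
    rewrite mnm_sumE -sum1_card [RHS]big_mkcond /=; apply: eq_bigr => j _.
    by rewrite mnm1E inE; case: eqP.
  apply/eqP/injectiveP => [e j k fjk|fI]; last first.
    apply/mnmP => i; rewrite cE mnmE.
    have /codomP[j ->] : i \in codom f by exact: injF_onto.
    by rewrite -(card1 j); apply: eq_card => k; rewrite !inE (inj_eq fI).
  have := congr1 (fun m : 'X_{1..n} => m (f j)) e; rewrite cE mnmE => /eqP/card1P[l lP].
  have /eqP -> : j == l by have := lP j; rewrite !inE eqxx => <-.
  by have /eqP -> : k == l by have := lP k; rewrite !inE fjk eqxx => <-.
have termE t : (\sum_(f : {ffun 'I_n -> 'I_n}) ((-1) ^+ odd_perm t * \prod_j X (f j) j
  (t j)) *:
    'X_[(\sum_(j < n) U_(f j))%MM])@_[multinom 1%N | _ < n] =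
  \sum_(s : 'S_n) (-1) ^+ odd_perm t * \prod_j X (s (t j)) j (t j).
  rewrite raddf_sum /= (bigID (fun f : {ffun _} => injectiveb f)) /= addrC big1 ?add0r;
    last first.
    by move=> f /negbTE fI; rewrite mcoeffZ mcoeffX sumE fI mulr0.
  rewrite (reindex_inj (mulgI t^-1%g)) /= (reindex (@pval _)) /=; last first.
    exists (fun f : {ffun _} => if @insub _ _ 'S_n f is Some s then s else 1%g) => f.
      by move=> _; rewrite valK.
    by rewrite inE => fI; rewrite insubT.
  apply: eq_big => [s|s sI]; first exact: valP s.
  rewrite mcoeffZ mcoeffX sumE sI mulr1; congr (_ * _); apply: eq_bigr => j _.
  by rewrite pvalE permM permK.
transitivity (\sum_(t : 'S_n) \sum_(s : 'S_n) (-1) ^+ odd_perm t * \prod_j X (s (t j))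
  j (t j)).
  by apply: eq_bigr => t _; exact: termE.
rewrite exchange_big /=; apply: eq_bigr => s _; rewrite /determinant.
by apply: eq_bigr => t _; congr (_ * _); apply: eq_bigr => j _; rewrite mxE.
Qed.

End MixedDiscriminant.

Section PolarizedDeterminant.
Variables (K : comNzRingType) (n : nat).
Implicit Types (X Y U V : 'I_n -> 'M[K]_n) (A B W : 'M[K]_n) (S T : {set 'I_n}).

Lemma pdetE X :
  pdet X = \sum_(s : 'S_n) \sum_(t : 'S_n) (-1) ^+ t * \prod_j X (s j) (t j) j.
Proof.
apply: eq_bigr => s _; rewrite -det_tr /determinant.
by apply: eq_bigr => t _; congr (_ * _); apply: eq_bigr => j _; rewrite !mxE.
Qed.

Lemma eq_pdet X Y : X =1 Y -> pdet X = pdet Y.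
Proof.
move=> XY; apply: eq_bigr => s _; congr (\det _).
by apply/matrixP => i j; rewrite !mxE XY.
Qed.

Lemma pdet_perm X (s : 'S_n) : pdet (X \o s) = pdet X.
Proof.
rewrite [RHS](reindex_inj (mulIg s)) /=; apply: eq_bigr => u _.
by congr (\det _); apply/matrixP => i j; rewrite !mxE permM.
Qed.

Lemma pdet_const A : pdet (fun=> A) = n`!%:R * \det A.
Proof.
rewrite /pdet (eq_bigr (fun=> \det A)); last first.
  by move=> s _; congr (\det _); apply/matrixP => i j; rewrite mxE.
by rewrite sumr_const card_Sn mulr_natl.
Qed.

Lemma pdet_scale (c : 'I_n -> K) X :
  pdet (fun i => c i *: X i) = (\prod_i c i) * pdet X.
Proof.
rewrite !pdetE big_distrr /=; apply: eq_bigr => s _.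
rewrite big_distrr /=; apply: eq_bigr => t _; rewrite mulrCA; congr (_ * _).
rewrite [\prod_i c i](reindex_inj (@perm_inj _ s)) -big_split /=.
by apply: eq_bigr => j _; rewrite mxE.
Qed.

Lemma pdet0 X k : X k = 0 -> pdet X = 0.
Proof.
move=> Xk; rewrite (@eq_pdet _ (fun i => (if i == k then 0 else 1) *: X i)).
  by rewrite pdet_scale (bigD1 k) //= eqxx !mul0r.
by move=> i; case: eqP => [->|]; rewrite ?Xk ?scaler0 ?scale1r.
Qed.

Lemma pdetD U V : pdet (fun i => U i + V i) =
  \sum_(T : {set 'I_n}) pdet (fun i => if i \in T then U i else V i).
Proof.
under [RHS]eq_bigr => T _ do rewrite pdetE.
rewrite pdetE [RHS]exchange_big /=; apply: eq_bigr => s _.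
rewrite [RHS]exchange_big /=; apply: eq_bigr => t _.
rewrite -big_distrr /=; congr (_ * _).
under eq_bigr => j _ do rewrite mxE.
rewrite bigA_distr (reindex (fun T : {set 'I_n} => s @^-1: T)) /=.
  apply: eq_bigr => T _; apply: eq_bigr => j _.
  by rewrite inE; case: ifP.
exists (fun T : {set 'I_n} => (s^-1)%g @^-1: T) => T _; apply/setP => i;
  by rewrite !inE ?permK ?permKV.
Qed.

(** The polynomial w |-> pdet (w U + V), given by its coefficients because
    these are what the arguments on roots refer to. *)
Definition pdet_pencil U V : {poly K} :=
  \sum_(T : {set 'I_n}) pdet (fun i => if i \in T then U i else V i) *: 'X^#|T|.

Lemma horner_pdet_pencil U V w :
  (pdet_pencil U V).[w] = pdet (fun i => w *: U i + V i).
Proof.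
rewrite pdetD horner_sum; apply: eq_bigr => T _; rewrite hornerZ hornerXn.
rewrite [RHS](@eq_pdet _ (fun i => (if i \in T then w else 1) *:
   (if i \in T then U i else V i))); last first.
  by move=> i; case: ifP; rewrite ?scale1r.
by rewrite pdet_scale mulrC -big_mkcond /= prodr_const.
Qed.

Lemma coef_pdet_pencil U V m : (pdet_pencil U V)`_m =
  \sum_(T : {set 'I_n} | #|T| == m) pdet (fun i => if i \in T then U i else V i).
Proof.
rewrite coef_sum [RHS]big_mkcond; apply: eq_bigr => T _.
by rewrite coefZ coefXn eq_sym; case: eqP => _; rewrite ?mulr1 ?mulr0.
Qed.

Lemma coef0_pdet_pencil U V : (pdet_pencil U V)`_0 = pdet V.
Proof.
rewrite coef_pdet_pencil (big_pred1 set0); last by move=> T; rewrite cards_eq0.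
by apply: eq_pdet => i; rewrite inE.
Qed.

Lemma coef1_pdet_pencil U V : (pdet_pencil U V)`_1 =
  \sum_k pdet (fun i => if i == k then U i else V i).
Proof.
rewrite coef_pdet_pencil (eq_bigl (mem [set [set k] | k in 'I_n])); last first.
  move=> T; apply/cards1P/imsetP => [[k ->]|[k _ ->]]; by exists k.
rewrite big_imset /=; last by move=> j k _ _; exact: set1_inj.
by apply: eq_bigr => k _; apply: eq_pdet => i; rewrite inE.
Qed.

(** A form of degree #|S| in A. Derivatives of the determinant in the
    directions X_k arise from S = setT by removing the indices k one at a
    time. *)
Definition pfill X S A : K := pdet (fun i => if i \in S then A else X i).

Lemma pfill0 X A : pfill X set0 A = pdet X.
Proof. by apply: eq_pdet => i; rewrite inE. Qed.

Lemma pfillT X A : pfill X setT A = n`!%:R * \det A.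
Proof. by rewrite -pdet_const; apply: eq_pdet => i; rewrite inE. Qed.

Lemma pfillZ X S (c : K) A : pfill X S (c *: A) = c ^+ #|S| * pfill X S A.
Proof.
rewrite -prodr_const big_mkcond -pdet_scale; apply: eq_pdet => i.
by case: ifP; rewrite ?scale1r.
Qed.

(** The zero outside S kills every choice of a slot outside S, so that the
    degree is at most #|S|. *)
Definition pfill_pencil X S W A : {poly K} :=
  pdet_pencil (fun i => if i \in S then W else 0) (fun i => if i \in S then A else X i).

Lemma horner_pfill_pencil X S W A w :
  (pfill_pencil X S W A).[w] = pfill X S (A + w *: W).
Proof.
rewrite horner_pdet_pencil; apply: eq_pdet => i.
by case: ifP; rewrite ?scaler0 ?add0r // addrC.
Qed.

Lemma coef0_pfill_pencil X S W A : (pfill_pencil X S W A)`_0 = pfill X S A.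
Proof. exact: coef0_pdet_pencil. Qed.

Lemma coef_pfill_pencil X S W A m : (pfill_pencil X S W A)`_m =
  \sum_(T : {set 'I_n} | (#|T| == m) && (T \subset S))
    pdet (fun i => if i \in T then W else if i \in S then A else X i).
Proof.
rewrite coef_pdet_pencil (bigID (fun T => T \subset S)) /= addrC big1 ?add0r.
  apply: eq_bigr => T /andP[_ /subsetP TS]; apply: eq_pdet => i.
  by case: ifP => // /TS ->.
by move=> T /andP[_ /subsetPn[k kT /negbTE kS]]; apply: (@pdet0 _ k); rewrite kT kS.
Qed.

Lemma size_pfill_pencil X S W A : (size (pfill_pencil X S W A) <= #|S|.+1)%N.
Proof.
apply/leq_sizeP => m Sm; rewrite coef_pfill_pencil big1 // => T /andP[/eqP Tm TS].
by have := leq_ltn_trans (subset_leq_card TS) Sm; rewrite Tm ltnn.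
Qed.

Lemma lead_pfill_pencil X S W A : (pfill_pencil X S W A)`_#|S| = pfill X S W.
Proof.
rewrite coef_pfill_pencil (big_pred1 S).
  by apply: eq_pdet => i; case: (i \in S).
by move=> T /=; rewrite eqEcard andbC; case TS: (T \subset S);
  rewrite ?andbF //= eqn_leq (subset_leq_card TS).
Qed.

Lemma pdet_swap X Y j k : X j = Y k -> X k = Y j ->
  (forall i, i != j -> i != k -> X i = Y i) -> pdet X = pdet Y.
Proof.
move=> Xj Xk XY; rewrite -(pdet_perm Y (tperm j k)); apply: eq_pdet => i /=.
by case: tpermP => [->|->|/eqP ij /eqP ik]; rewrite ?Xj ?Xk ?XY.
Qed.

(** By symmetry of [pdet], each of the #|S| slots contributes the same to the
    derivative. *)
Lemma coef1_pfill_pencil X S A k : k \in S ->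
  (pfill_pencil X S (X k) A)`_1 = #|S|%:R * pfill X (S :\ k) A.
Proof.
move=> kS; rewrite coef1_pdet_pencil (bigID (mem S)) /= addrC big1 ?add0r.
  rewrite -[#|S|]sum1_card natr_sum mulr_suml; apply: eq_bigr => j jS.
  rewrite mul1r; apply: (pdet_swap (j := j) (k := k)).
  - by rewrite eqxx jS !inE eqxx.
  - by rewrite kS in_setD1 jS andbT eq_sym; case: eqP => [->|].
  - by move=> i ij ik; rewrite (negbTE ij) !inE ik.
by move=> j /negbTE jS; apply: (@pdet0 _ j); rewrite eqxx jS.
Qed.

(** When one column of A is replaced by the same column of W, cofactor
    expansion gives a diagonal entry of adj A * W; every diagonal position
    comes from (n-1)! permutations. *)
Lemma pdet_adj k W A :
  pdet (fun i => if i == k then W else A) = n.-1`!%:R * \tr (\adj A *m W).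
Proof.
have detE (s : 'S_n) : \det (\matrix_(i, j) (if s j == k then W else A) i j) =
    (\adj A *m W) (s^-1%g k) (s^-1%g k).
  rewrite (expand_det_col _ (s^-1%g k)) !mxE; apply: eq_bigr => i _.
  rewrite !mxE permKV eqxx mulrC; congr (_ * _); congr (_ * \det _).
  apply/matrixP => a b; rewrite !mxE -(inj_eq (@perm_inj _ s^-1%g)) permK.
  by rewrite eq_sym (negbTE (neq_lift _ _)).
rewrite /pdet (eq_bigr _ (fun s _ => detE s)) (reindex_inj invg_inj) /=.
under eq_bigr => s _ do rewrite invgK.
rewrite (partition_big (fun s : 'S_n => s k) predT) //= /mxtrace mulr_sumr.
apply: eq_bigr => i _.
rewrite (eq_bigr (fun=> (\adj A *m W) i i)); last by move=> s /eqP ->.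
rewrite sumr_const -[LHS]mulr_natl; congr (_%:R * _).
have <- : #|[set~ k]|`! = n.-1`! by rewrite cardsC1 card_ord.
rewrite -card_perm -!sum1_card (reindex_inj (mulIg (tperm k i))) /=.
apply: eq_bigl => s; rewrite -!topredE /= permM.
rewrite -[eqn _ _]/(tperm k i (s k) == i :> 'I_n) (canF_eq (tpermK k i)) tpermR;
  apply/eqP/subsetP => [sk j|sP].
  by rewrite !inE; apply: contraNneq => ->; rewrite sk.
by apply/eqP; apply: contraT => sk; have := sP k; rewrite !inE eqxx => /(_ sk).
Qed.

End PolarizedDeterminant.

(** * Polynomials with roots in a half-plane or on a half-line *)

Section RootLocation.
Variable K : numClosedFieldType.
Implicit Types (p : {poly K}) (r w z : K) (rs bs : seq K).

Lemma Re_inv_lt0 r : 'Re r < 0 -> 'Re r^-1 < 0.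
Proof.
move=> r0; have rn0 : r != 0 by apply: contraTneq r0 => ->; rewrite raddf0 ltxx.
by rewrite ReV pmulr_llt0 // invr_gt0 exprn_gt0 // normr_gt0.
Qed.

(** Gauss-Lucas at the single point 0: p'(0) / p(0) is the sum of - 1/r over
    the roots r, and each term has positive real part. *)
Lemma left_half_plane_coef1 p : (1 < size p)%N ->
  (forall w, 0 <= 'Re w -> p.[w] != 0) -> p`_1 != 0.
Proof.
move=> p1 pN; have pn0 : p != 0 by rewrite -size_poly_gt0 ltnW.
have [rs pE] := closed_field_poly_normal p.
have rsN : all (fun r => 'Re r < 0) rs.
  apply/allP => r rrs; rewrite real_ltNge ?rpred0 ?Creal_Re //.
  apply: contraTN isT => /pN; rewrite pE hornerZ mulf_eq0 negb_or => /andP[_].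
  by rewrite -[_ == 0]/(root _ r) root_prod_XsubC rrs.
have rs0 : rs != [::].
  apply: contraTneq p1 => rs0; rewrite pE rs0 big_nil alg_polyC -leqNgt.
  by rewrite (leq_trans (size_polyC_leq1 _)).
have key rs' : all (fun r => 'Re r < 0) rs' ->
  let q := \prod_(r <- rs') ('X - r%:P) in
  q.[0] != 0 /\ (if rs' == [::] then q^`().[0] = 0 else 0 < 'Re (q^`().[0] / q.[0])).
  elim: rs' => [|r rs' IH] /=; first by rewrite big_nil derivC !hornerC oner_eq0.
  move=> /andP[r0 /IH[q0 q1]]; rewrite big_cons.
  set q := \prod_(_ <- _) _ in q0 q1 *.
  have rn0 : r != 0 by apply: contraTneq r0 => ->; rewrite raddf0 ltxx.
  rewrite derivM derivXsubC mul1r hornerD !hornerM !hornerXsubC sub0r.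
  split; first by rewrite mulf_neq0 ?oppr_eq0.
  have -> : (q.[0] + - r * q^`().[0]) / (- r * q.[0]) = - r^-1 + q^`().[0] / q.[0].
    by field; rewrite q0 rn0.
  rewrite raddfD raddfN /= ltr_wpDr ?oppr_gt0 ?Re_inv_lt0 //.
  by case: ifP q1 => _; [move=> ->; rewrite mul0r raddf0 | move/ltW].
have := key _ rsN; rewrite (negbTE rs0) => -[_ q1].
have -> : p`_1 = p^`().[0] by rewrite horner_coef0 coef_deriv.
rewrite pE derivZ hornerZ mulf_neq0 ?lead_coef_eq0 //.
by apply: contraTneq q1 => ->; rewrite mul0r raddf0 ltxx.
Qed.

(** A root r < 0 contributes the factor 1 + b X with b = - 1/r. Zeros pad the
    list to length d, so that AM-GM can be used with exponent d whatever the
    degree of p. *)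
Lemma neg_roots_factor p d : (size p <= d.+1)%N -> p != 0 ->
    (forall r, root p r -> r < 0) ->
  exists bs, [/\ size bs = d, all (fun b => 0 <= b) bs,
     p = p`_0 *: \prod_(b <- bs) (1 + b *: 'X), p`_0 != 0 &
     p`_1 = p`_0 * \sum_(b <- bs) b /\ ((1 < size p)%N -> 0 < \sum_(b <- bs) b)].
Proof.
move=> pd pn0 pN; have [rs pE] := closed_field_poly_normal p.
have rsN r : r \in rs -> r < 0.
  by move=> rrs; apply: pN; rewrite pE rootZ ?lead_coef_eq0 // root_prod_XsubC.
have sp : size p = (size rs).+1.
  by rewrite [in LHS]pE size_scale ?lead_coef_eq0 // size_prod_XsubC.
pose bs := [seq - r^-1 | r <- rs] ++ nseq (d - size rs) 0.
have prodE : \prod_(b <- bs) (1 + b *: 'X) = \prod_(r <- rs) (1 - r^-1 *: 'X).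
  rewrite big_cat /= big_map [X in _ * X]big1_seq ?mulr1.
    by apply: eq_bigr => r _; rewrite scaleNr.
  by move=> b /= /nseqP[-> _]; rewrite scale0r addr0.
have coefs (cs : seq K) : (\prod_(b <- cs) (1 + b *: 'X))`_0 = 1 /\
    (\prod_(b <- cs) (1 + b *: 'X))`_1 = \sum_(b <- cs) b.
  elim: cs => [|b cs [IH0 IH1]]; first by rewrite !big_nil !coef1.
  rewrite !big_cons mulrDl mul1r -scalerAl !coefD !coefZ !coefXM /= IH0 IH1.
  by rewrite mulr0 mulr1 addr0 addrC.
have pE0 : p = p`_0 *: \prod_(b <- bs) (1 + b *: 'X).
  have pc : p = (lead_coef p * \prod_(r <- rs) (- r)) *: \prod_(b <- bs) (1 + b *: 'X).
    rewrite [LHS]pE prodE -scalerA; congr (_ *: _).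
    elim: rs rsN {pE sp bs prodE} => [|r rs IH] rsN; first by rewrite !big_nil scale1r.
    rewrite !big_cons IH; last by move=> x xrs; apply: rsN; rewrite inE xrs orbT.
    rewrite scalerAr -scalerA mulrC -scalerAr mulrC scalerAl; congr (_ * _).
    have rn0 : r != 0 by rewrite lt_eqF // rsN // mem_head.
    by rewrite scalerBr scalerA mulNr divff // scaleN1r opprK scaleNr alg_polyC addrC.
  have e0 : p`_0 = lead_coef p * \prod_(r <- rs) (- r).
    by rewrite [in LHS]pc coefZ (coefs _).1 mulr1.
  by rewrite e0.
exists bs; split => //.
- by rewrite size_cat size_map size_nseq subnKC // -ltnS -sp.
- rewrite all_cat all_map; apply/andP; split; apply/allP => r /=.
    by move/rsN => r0; rewrite oppr_ge0 invr_le0 ltW.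
  by case/nseqP => ->.
- by apply: contraNneq pn0 => p0; rewrite pE0 p0 scale0r.
split; first by rewrite [in LHS]pE0 coefZ (coefs _).2.
rewrite sp ltnS => rs0; rewrite big_cat /= [X in _ + X]big1_seq ?addr0; last first.
  by move=> b /= /nseqP[].
rewrite big_map; case: rs rs0 rsN {pE sp bs prodE pE0} => [|r rs] // _ rsN.
rewrite big_cons ltr_wpDr //; last by rewrite oppr_gt0 invr_lt0 rsN ?mem_head.
rewrite big_seq; apply: sumr_ge0 => x xrs; rewrite oppr_ge0 invr_le0 ltW //.
by apply: rsN; rewrite inE xrs orbT.
Qed.

(** AM-GM for the factors 1 + b s. Multiplying by a power of p`_0 removes the
    division by p`_0, so that the inequality keeps its meaning when p`_0 tends
    to 0. *)
Lemma neg_roots_tangent p d s : (0 < d)%N -> (size p <= d.+1)%N -> 0 < p`_0 ->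
    (forall r, root p r -> r < 0) -> 0 <= s ->
  p`_0 ^+ d.-1 * p.[s] <= (p`_0 + s * (p`_1 / d%:R)) ^+ d.
Proof.
move=> d0 pd p0 pN s0; have pn0 : p != 0.
  by apply: contraTneq p0 => ->; rewrite coef0 ltxx.
have [bs [bsd /allP bs0 pE _ [p1 _]]] := neg_roots_factor pd pn0 pN.
have hE : p.[s] = p`_0 * \prod_(i < d) (1 + bs`_i * s).
  rewrite [in LHS]pE hornerZ horner_prod (big_nth 0) bsd big_mkord; congr (_ * _).
  by apply: eq_bigr => i _; rewrite !hornerE.
have := leif_AGM (A := predT) (E := fun i : 'I_d => 1 + bs`_i * s).
case=> [i _|+ _]; first by rewrite addr_ge0 ?mulr_ge0 // bs0 // mem_nth // bsd.
rewrite card_ord big_split /= sumr_const card_ord -mulr_suml.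
have -> : \sum_(i < d) bs`_i = p`_1 / p`_0.
  by rewrite p1 (big_nth 0) bsd big_mkord mulrAC divff ?mul1r // gt_eqF.
move=> agm; rewrite hE mulrA -exprSr prednK //.
apply: le_trans (ler_wpM2l _ agm) _; first by rewrite exprn_ge0 // ltW.
rewrite -exprMn le_eqVlt; apply/orP; left; apply/eqP; congr (_ ^+ _).
by field; rewrite pnatr_eq0 -lt0n d0 gt_eqF.
Qed.

(** Write p = q X + c. On the unit disk q is bounded, so |c| - Re c is at most
    a constant times e for all small e > 0; hence |c| = Re c. *)
Lemma poly_nonneg_limit p : (forall e : K, 0 < e -> 0 <= p.[e]) -> 0 <= p.[0].
Proof.
elim/poly_ind: p => [|q c _] pP; first by rewrite horner0.
rewrite hornerMXaddC mulr0 add0r.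
have [M qM] := poly_disk_bound q 1.
have M0 : 0 <= M by rewrite (le_trans (normr_ge0 q.[1])) ?qM ?normr1.
have small e : 0 < e -> e <= 1 -> `|c| - 'Re c <= e * (M + M).
  move=> e0 e1; have := pP e e0; rewrite hornerMXaddC => pe.
  have eq : `|q.[e] * e| <= e * M.
    by rewrite normrM (gtr0_norm e0) mulrC ler_pM2l // qM ?gtr0_norm.
  rewrite lerBlDr mulrDr -addrA; apply: le_trans (_ : _ <= e * M + `|q.[e] * e + c|) _.
    rewrite addrC -lerBlDr; apply: le_trans (_ : _ <= `|c| - `|q.[e] * e|) _.
      by rewrite lerD2l lerN2.
    by rewrite [q.[e] * e + c]addrC lerB_normD.
  rewrite lerD2l (ger0_norm pe) -(Creal_ReP _ (ger0_real pe)) raddfD /= lerD2r.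
  by rewrite (le_trans _ eq) // leif_Re_Creal.
rewrite -(leif_Re_Creal c) eq_le leif_Re_Creal -subr_le0.
have rx : `|c| - 'Re c \is Num.real by rewrite rpredB ?normr_real ?Creal_Re.
rewrite real_leNgt ?rpred0 //; apply/negP => {rx}; move: (_ - _) small => x small x0.
have x0' := ltW x0.
have N0 : 0 < (M + M + x) *+ 2 by rewrite pmulrn_rgt0 // ltr_wpDl // addr_ge0.
have := small (x / ((M + M + x) *+ 2)); rewrite divr_gt0 // => /(_ isT).
rewrite ler_pdivrMr // mul1r [leRHS]mulr2n -[leRHS]addrA ler_wpDl ?lerDl ?addr_ge0 //.
move=> /(_ isT); rewrite mulrAC ler_pdivlMr // ler_pM2l // => h.
have : M + M < (M + M + x) *+ 2.
  by rewrite mulr2n -addrA ltrDl ltr_wpDr // !addr_ge0.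
by move/lt_geF; rewrite h.
Qed.

End RootLocation.

(** * Definite matrices and roots of mixed discriminants *)

Section Definite.
Variables (K : numClosedFieldType) (n : nat).
Implicit Types (A B Z : 'M[K]_n) (v : 'cV[K]_n) (X : 'I_n -> 'M[K]_n) (S : {set 'I_n}).

Definition qform A v : K := (v ^t* *m A *m v) 0 0.
Definition psd A := A \is hermsymmx /\ forall v, 0 <= qform A v.
Definition pd A := A \is hermsymmx /\ forall v, v != 0 -> 0 < qform A v.
(** The Hermitian part is positive definite. *)
Definition accretive A := forall v, v != 0 -> 0 < 'Re (qform A v).

Lemma hermP A : reflect (forall i j, A i j = (A j i)^*) (A \is hermsymmx).
Proof.
apply: (iffP (is_hermitianmxP false Num.conj_op A)) => [AE i j|AE].
  by rewrite [in LHS]AE expr0 scale1r !mxE.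
by rewrite expr0 scale1r; apply/matrixP => i j; rewrite !mxE AE.
Qed.

Lemma qformD A B v : qform (A + B) v = qform A v + qform B v.
Proof. by rewrite /qform mulmxDr mulmxDl mxE. Qed.

Lemma qformZ (c : K) A v : qform (c *: A) v = c * qform A v.
Proof. by rewrite /qform -scalemxAr -scalemxAl mxE. Qed.

Lemma qform1 v : qform 1%:M v = \sum_i `|v i 0| ^+ 2.
Proof.
rewrite /qform mulmx1 mxE; apply: eq_bigr => i _.
by rewrite !mxE normCKC.
Qed.

Lemma qform1_gt0 v : v != 0 -> 0 < qform 1%:M v.
Proof.
move=> vn0; rewrite qform1 lt_def sumr_ge0 ?andbT => [|i _]; last by rewrite exprn_ge0.
apply: contraNneq vn0 => /psumr_eq0P v0; apply/eqP/matrixP => i j.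
rewrite ord1 mxE; apply/eqP; rewrite -normr_eq0 -sqrf_eq0.
by rewrite v0 // => k _; rewrite exprn_ge0.
Qed.

Lemma psdD A B : psd A -> psd B -> psd (A + B).
Proof.
move=> [/hermP hA pA] [/hermP hB pB]; split.
  by apply/hermP => i j; rewrite !mxE rmorphD /= -hA -hB.
by move=> v; rewrite qformD addr_ge0.
Qed.

Lemma psdZ (c : K) A : 0 <= c -> psd A -> psd (c *: A).
Proof.
move=> c0 [/hermP hA pA]; split.
  by apply/hermP => i j; rewrite !mxE rmorphM /= -hA conj_Creal // ger0_real.
by move=> v; rewrite qformZ mulr_ge0.
Qed.

Lemma psd0 : psd 0.
Proof.
split; first by apply/hermP => i j; rewrite !mxE conjC0.
by move=> v; rewrite /qform mulmx0 mul0mx mxE.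
Qed.

Lemma psd_sum (I : Type) (r : seq I) (P : pred I) (F : I -> 'M[K]_n) :
  (forall i, P i -> psd (F i)) -> psd (\sum_(i <- r | P i) F i).
Proof. by move=> FP; apply: big_ind => //; [exact: psd0|exact: psdD]. Qed.

Lemma pd1 : pd 1%:M.
Proof. by split; [exact: hermitian1mx_subproof|exact: qform1_gt0]. Qed.

Lemma pd_psd A : pd A -> psd A.
Proof.
case=> hA pA; split=> // v; have [->|/pA/ltW//] := eqVneq v 0.
by rewrite /qform mulmx0 mxE.
Qed.

Lemma psd_pdD A B : psd A -> pd B -> pd (A + B).
Proof.
move=> pA pB; split; first by have [] := psdD pA (pd_psd pB).
by move=> v v0; rewrite qformD ltr_wpDl ?(proj2 pA) // (proj2 pB).
Qed.

Lemma pdZ (c : K) A : 0 < c -> pd A -> pd (c *: A).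
Proof.
move=> c0 pA; split; first by have [] := psdZ (ltW c0) (pd_psd pA).
by move=> v v0; rewrite qformZ mulr_gt0 // (proj2 pA).
Qed.

(** This excludes roots w that are not negative reals: for these, some c
    satisfies the two conditions. *)
Lemma accretive_pdD A B w : pd A -> pd B -> forall c, 0 < 'Re c -> 0 <= 'Re (c * w) ->
  accretive (c *: (A + w *: B)).
Proof.
move=> pA pB c c0 cw v v0; have a0 := (proj2 pA) v v0; have b0 := (proj2 pB) v v0.
rewrite qformZ qformD qformZ mulrDr mulrA raddfD /= (ReMr (gtr0_real a0)) (ReMr
  (gtr0_real b0)).
by rewrite ltr_wpDr ?mulr_ge0 ?mulr_gt0 // ltW.
Qed.

Lemma accretive_det A : accretive A -> \det A != 0.
Proof.
move=> aA; apply/det0P => -[u u0 uA].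
have ut0 : u ^t* != 0.
  apply: contraNneq u0 => /(congr1 (fun M => M ^t*)).
  by rewrite trmxCK => ->; rewrite trmx0 map_mx0.
by have := aA _ ut0; rewrite /qform trmxCK uA mul0mx mxE raddf0 ltxx.
Qed.

Lemma spectral_decomposition A : A \is hermsymmx ->
  exists P : 'M[K]_n, exists d : 'rV[K]_n, [/\ P \is unitarymx,
    A = P ^t* *m diag_mx d *m P &
    forall j, col j (P ^t*) != 0 /\ d 0 j = qform A (col j (P ^t*))].
Proof.
move=> hA; have /orthomx_spectralP := hermitian_normalmx hA.
set P := spectralmx A; set d := spectral_diag A => AE.
have uP : P \is unitarymx := spectral_unitarymx A.
rewrite invmx_unitary // in AE.
exists P, d; split=> // j.
have PP : P *m P ^t* = 1%:M by apply/unitarymxP.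
have cE : P *m col j (P ^t*) = delta_mx j 0 by rewrite colE mulmxA PP mul1mx.
split.
  apply: contra_eqN cE => /eqP ->; rewrite mulmx0 eq_sym.
  by apply/eqP => /matrixP/(_ j 0); rewrite !mxE !eqxx => /eqP; rewrite oner_eq0.
have cE' : (col j (P ^t*)) ^t* *m P ^t* = delta_mx 0 j.
  by rewrite -map_mxM -trmx_mul cE trmx_delta map_delta_mx.
rewrite /qform AE !mulmxA cE' -!mulmxA cE.
rewrite [diag_mx d *m _]mul_diag_mx.
by rewrite -rowE !mxE !eqxx mulr1.
Qed.

Lemma spectral_det (P : 'M[K]_n) (d : 'rV[K]_n) : P \is unitarymx ->
  \det (P ^t* *m diag_mx d *m P) = \prod_j d 0 j.
Proof.
move=> uP; rewrite !det_mulmx mulrAC -det_mulmx.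
have -> : P ^t* *m P = 1%:M.
  by rewrite -invmx_unitary // mulVmx // unitarymx_unit.
by rewrite det1 mul1r det_diag.
Qed.

Lemma pd_det_gt0 A : pd A -> 0 < \det A.
Proof.
case=> hA pA; have [P [d [uP AE dP]]] := spectral_decomposition hA.
rewrite AE spectral_det // prodr_gt0 // => j _.
by have [c0 dE] := dP j; rewrite dE pA.
Qed.

Lemma pd_accretive A : pd A -> accretive A.
Proof.
by move=> pA v /(proj2 pA) q0; rewrite (Creal_ReP _ (gtr0_real q0)).
Qed.

Section PositiveTuple.
Variable X : 'I_n -> 'M[K]_n.
Hypothesis pX : forall i, pd (X i).

(** Induction on the number of slots filled by X. Free the slot k as well: the
    polynomial w |-> pfill X (k |: S) (Z + w X_k) has no root with Re w >= 0,
    as Z + w X_k is accretive for such w, and it is not constant, as its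
    leading coefficient is the value at X_k. So its coefficient of degree 1, a
    multiple of pfill X S Z, is not 0. *)
Lemma pfill_accretive_neq0 S Z : accretive Z -> pfill X S Z != 0.
Proof.
move En : #|~: S| => m; elim: m S En Z => [|m IH] S En Z aZ.
  have -> : S = setT by rewrite -[S]setCK (cards0_eq En) setC0.
  by rewrite pfillT mulf_neq0 ?accretive_det // pnatr_eq0 -lt0n fact_gt0.
have [k kS] : exists k, k \in ~: S by apply/card_gt0P; rewrite En.
rewrite inE in kS; pose S' := k |: S.
have S'k : S' :\ k = S by rewrite setU1K.
have kS' : k \in S' by rewrite !inE eqxx.
have Em : #|~: S'| = m.
  by apply/eqP; rewrite -eqSS -En setCU setIC -setDE (cardsD1 k (~: S)) inE kS.
pose p := pfill_pencil X S' (X k) Z.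
suff : p`_1 != 0 by rewrite coef1_pfill_pencil // S'k mulf_eq0 negb_or => /andP[].
apply: left_half_plane_coef1.
  have S'0 : (0 < #|S'|)%N by apply/card_gt0P; exists k.
  rewrite (leq_ltn_trans S'0) // ltnNge; apply/negP => /leq_sizeP/(_ _ (leqnn _))/eqP.
  apply/negP; rewrite lead_pfill_pencil; exact/IH/pd_accretive.
move=> w w0; rewrite horner_pfill_pencil; apply: IH => // v v0.
have q0 := (proj2 (pX k)) v v0.
rewrite qformD qformZ raddfD /= (ReMr (gtr0_real q0)).
by rewrite ltr_wpDr ?aZ // mulr_ge0 // ltW.
Qed.

(** If r is not a negative real, then c = |r| + r^* makes c (A + r X_k)
    accretive, and the form cannot vanish at this multiple of A + r X_k. *)
Lemma pfill_pencil_root S A k r : pd A -> root (pfill_pencil X S (X k) A) r -> r < 0.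
Proof.
move=> pA; rewrite /root horner_pfill_pencil => pr.
have r0 : r != 0.
  apply: contraTneq pr => ->; rewrite scale0r addr0.
  exact/pfill_accretive_neq0/pd_accretive.
rewrite lt_def eq_sym r0 /= -oppr_ge0 -(leif_Re_Creal (- r)).
apply: contraTT pr => rN; pose c := `|r| + r^*.
have Rer : - 'Re r < `|r|.
  by rewrite -raddfN lt_neqAle -[`|r|]normrN rN leif_Re_Creal.
have c0 : 0 < 'Re c.
  rewrite raddfD /= Re_conj (Creal_ReP _ (normr_real r)).
  by rewrite -ltrBlDr sub0r.
have cr : 0 <= 'Re (c * r).
  rewrite mulrDl -normCKC raddfD /= (ReMl (normr_real r)).
  rewrite (Creal_ReP (`|r| ^+ 2) (rpredX _ (normr_real r))) expr2 -mulrDr.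
  by rewrite mulr_ge0 // -lerBlDl sub0r ltW.
have := pfill_accretive_neq0 S (accretive_pdD pA (pX k) c0 cr).
by rewrite pfillZ mulf_eq0 negb_or => /andP[].
Qed.

(** The ratio of the two values is the sum of - 1/r over the roots r < 0, up
    to a positive factor. *)
Lemma pfill_gt0_coef S A k : pd A -> k \in S -> 0 < pfill X S A ->
  0 < pfill X (S :\ k) A.
Proof.
move=> pA kS p0; pose p := pfill_pencil X S (X k) A.
have S0 : (0 < #|S|)%N by apply/card_gt0P; exists k.
have sz1 : (1 < size p)%N.
  rewrite (leq_ltn_trans S0) // ltnNge; apply/negP => /leq_sizeP/(_ _ (leqnn _))/eqP.
  by apply/negP; rewrite lead_pfill_pencil; exact/pfill_accretive_neq0/pd_accretive.
have pn0 : p != 0 by rewrite -size_poly_gt0 ltnW.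
have rN r : root p r -> r < 0 by exact: pfill_pencil_root.
have [bs [_ _ _ _ [p1 /(_ sz1) b0]]] := neg_roots_factor (leqnSn (size p)) pn0 rN.
rewrite coef0_pfill_pencil coef1_pfill_pencil // in p1.
by rewrite -(pmulr_rgt0 _ (_ : 0 < #|S|%:R)) ?ltr0n // p1 mulr_gt0.
Qed.

Lemma pfill_gt0 S A : pd A -> 0 < pfill X S A.
Proof.
move=> pA; move En : #|~: S| => m; elim: m S En => [|m IH] S En.
  have -> : S = setT by rewrite -[S]setCK (cards0_eq En) setC0.
  by rewrite pfillT mulr_gt0 ?pd_det_gt0 // ltr0n fact_gt0.
have [k kS] : exists k, k \in ~: S by apply/card_gt0P; rewrite En.
rewrite inE in kS; rewrite -(setU1K kS); apply: pfill_gt0_coef => //.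
  by rewrite !inE eqxx.
by apply: IH; apply/eqP; rewrite -eqSS -En setCU setIC -setDE (cardsD1 k (~: S)) inE kS.
Qed.

Lemma pfill_tangent_pd S A k s : pd A -> k \in S -> 0 <= s ->
  pfill X S A ^+ #|S|.-1 * pfill X S (A + s *: X k)
    <= (pfill X S A + s * pfill X (S :\ k) A) ^+ #|S|.
Proof.
move=> pA kS s0; have S0 : (0 < #|S|)%N by apply/card_gt0P; exists k.
have := @neg_roots_tangent _ (pfill_pencil X S (X k) A) _ s S0 (size_pfill_pencil _ _ _ _).
rewrite coef0_pfill_pencil coef1_pfill_pencil // horner_pfill_pencil.
rewrite mulrAC mulfV ?mul1r ?pnatr_eq0 -?lt0n //; apply=> //; first exact: pfill_gt0.
by move=> r; exact: pfill_pencil_root.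
Qed.

End PositiveTuple.

Section NonnegativeTuple.
Variable X : 'I_n -> 'M[K]_n.
Hypothesis pX : forall i, psd (X i).

Let shift (X : 'I_n -> 'M[K]_n) S A (c : K) : {poly K} :=
  pdet_pencil (fun i => (if i \in S then c else 1)%:M) (fun i => if i \in S then A else
    X i).

Let horner_shift S A c e : (shift X S A c).[e] =
  pfill (fun i => X i + e *: 1%:M) S (A + (e * c) *: 1%:M).
Proof.
rewrite horner_pdet_pencil; apply: eq_pdet => i.
by case: ifP => _; rewrite addrC !scale_scalar_mx ?mulr1.
Qed.

Let horner_shift0 S A c : (shift X S A c).[0] = pfill X S A.
Proof.
rewrite horner_shift mul0r scale0r addr0; apply: eq_pdet => i.
by case: ifP => _; rewrite ?scale0r ?addr0.
Qed.

Let pX_shift e : 0 < e -> forall i, pd (X i + e *: 1%:M).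
Proof. by move=> e0 i; apply: psd_pdD => //; exact: pdZ pd1. Qed.

Lemma pfill_ge0 S A : psd A -> 0 <= pfill X S A.
Proof.
move=> pA; rewrite -(horner_shift0 S A 1); apply: poly_nonneg_limit => e e0.
rewrite horner_shift mulr1 ltW // pfill_gt0 //; first exact: pX_shift.
by apply: psd_pdD => //; exact: pdZ pd1.
Qed.

(** Adding e to all matrices makes them definite and turns both sides into
    polynomials in e; let e tend to 0. *)
Lemma pfill_tangent S A k s : psd A -> k \in S -> 0 <= s ->
  pfill X S A ^+ #|S|.-1 * pfill X S (A + s *: X k)
    <= (pfill X S A + s * pfill X (S :\ k) A) ^+ #|S|.
Proof.
move=> pA kS s0; rewrite -subr_ge0.
(* A + s X_k moves by (1 + s) e when A and X_k both move by e. *)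
pose p := (shift X S A 1 + s *: shift X (S :\ k) A 1) ^+ #|S| -
  (shift X S A 1) ^+ #|S|.-1 * shift X S (A + s *: X k) (1 + s).
have -> : (pfill X S A + s * pfill X (S :\ k) A) ^+ #|S| -
  pfill X S A ^+ #|S|.-1 * pfill X S (A + s *: X k) = p.[0].
  by rewrite /p !(hornerE, horner_exp) !horner_shift0.
apply: poly_nonneg_limit => e e0; rewrite /p !(hornerE, horner_exp) !horner_shift subr_ge0.
have pe := pX_shift e0.
have pAe : pd (A + (e * 1) *: 1%:M) by apply: psd_pdD => //; apply: pdZ pd1; rewrite mulr1.
have := pfill_tangent_pd pe pAe kS s0; congr (_ * pfill _ _ _ <= _).
by rewrite scalerDr scalerA addrACA -scalerDl mulrDr [s * e]mulrC.
Qed.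

End NonnegativeTuple.

End Definite.

(** * One step of the capacity descent *)

Section CapacityStep.
Variable K : numClosedFieldType.

(** With d = e.+1 and a = p`_0, compare the two bounds at s = a / (e b), where
    (a + s b)^d / s is minimal. If a = 0 there is no such s; then p.[s] / s
    tends to p`_1, and the conclusion is strict because g < 1/d. For d = 1 the
    upper bound is linear in s, and s = 1 will do. *)
Lemma capacity_step (p : {poly K}) (e : nat) (b c : K) :
    p`_1 = e.+1%:R * b -> 0 <= p`_0 -> 0 <= b -> 0 < c -> (e = 0%N -> p`_0 = 0) ->
    (forall s, 0 < s -> c * s <= p.[s]) ->
    (forall s, 0 <= s -> p`_0 ^+ e * p.[s] <= (p`_0 + s * b) ^+ e.+1) ->
  let g := e%:R ^+ e / e.+1%:R ^+ e.+1 in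
  c * g <= b /\
  (b = c * g -> exists2 s, 0 < s &
     [/\ p.[s] = c * s, p`_0 ^+ e * p.[s] = (p`_0 + s * b) ^+ e.+1
       & (0 < e)%N -> 0 < p`_0]).
Proof.
set a := p`_0 => p1 a0 b0 c0 ea lower upper g.
case: e ea p1 upper @g => [|e] ea p1 upper g.
  have a_0 : a = 0 by exact: ea.
  have := upper 1 ler01; rewrite expr0 mul1r a_0 add0r mul1r expr1 => pb.
  have cp := lower 1 ltr01; rewrite mulr1 in cp.
  rewrite /g expr0 expr1 divr1 mulr1; split; first exact: le_trans pb.
  move=> bc; exists 1 => //; have p_c : p.[1] = c by apply/eqP; rewrite eq_le cp -bc pb.
  by split; rewrite ?mulr1 ?expr0 ?mul1r ?a_0 ?add0r ?expr1 // p_c bc.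
have g0 : 0 < g by rewrite divr_gt0 // exprn_gt0 // ltr0n.
have gd : g < e.+2%:R^-1.
  rewrite /g [e.+2%:R ^+ _]exprS invfM mulrCA gtr_pMr ?invr_gt0 ?ltr0n //.
  by rewrite ltr_pdivrMr ?exprn_gt0 ?ltr0n // mul1r ltrXn2r ?ltr_nat ?ler0n.
have [a_0|an0] := eqVneq a 0.
  have cb : c <= e.+2%:R * b.
    rewrite -p1; have [q pq] : exists q, p = q * 'X.
      exists (p %/ 'X); rewrite divpK // -[X in X %| _]subr0 -polyC0 dvdp_XsubCl.
      by rewrite /root horner_coef0 -/a a_0.
    rewrite pq coefMX /= -horner_coef0 -subr_ge0.
    have := @poly_nonneg_limit _ (q - c%:P); rewrite !hornerE; apply=> s s0.
    rewrite !hornerE subr_ge0 -(ler_pM2r s0) (le_trans (lower s s0)) //.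
    by rewrite pq !hornerE.
  have lt_b : c * g < b.
    rewrite (lt_le_trans (_ : _ < c / e.+2%:R)) //; first by rewrite ltr_pM2l.
    by rewrite ler_pdivrMr ?ltr0n // mulrC.
  by split=> [|bc]; [exact: ltW|move: lt_b; rewrite -bc ltxx].
have {an0}a_gt0 : 0 < a by rewrite lt_def an0.
have {b0}b_gt0 : 0 < b.
  rewrite lt_def b0 andbT; apply/eqP => b_0; pose s := (a + a) / c.
  have s0 : 0 < s by rewrite divr_gt0 // addr_gt0.
  have := le_trans (ler_wpM2l (exprn_ge0 e.+1 a0) (lower s s0)) (upper s (ltW s0)).
  rewrite b_0 mulr0 addr0 [leRHS]exprSr ler_pM2l ?exprn_gt0 // /s mulrC divfK ?gt_eqF //.
  by rewrite gerDl => /le_gtF; rewrite a_gt0.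
(* The minimizer of (a + s b)^d / s; here d = e.+2. *)
pose s := a / (e.+1%:R * b).
have e1 : 0 < e.+1%:R :> K by rewrite ltr0n.
have e2 : 0 < e.+2%:R :> K by rewrite ltr0n.
have s0 : 0 < s by rewrite divr_gt0 // mulr_gt0.
have tE : (a + s * b) ^+ e.+2 = a ^+ e.+1 * (b / g * s).
  have -> : a + s * b = a * (e.+2%:R / e.+1%:R).
    rewrite /s -[e.+2]addn1 natrD; move: (e.+1%:R : K) e1 => x x0.
    by field; rewrite !gt_eqF.
  rewrite /g /s exprMn exprSr -!mulrA; congr (_ * _).
  rewrite expr_div_n invf_div [e.+1%:R ^+ e.+2]exprSr.
  have x0 := exprn_gt0 e.+1 e1; have y0 := exprn_gt0 e.+2 e2.
  move: (e.+1%:R ^+ e.+1 : K) (e.+2%:R ^+ e.+2 : K) (e.+1%:R : K) x0 y0 e1.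
  by move=> x y z x0 y0 z0; field; rewrite !gt_eqF.
have mid := ler_wpM2l (exprn_ge0 e.+1 a0) (lower s s0).
have up := upper s (ltW s0).
split.
  have := le_trans mid up; rewrite tE ler_pM2l ?exprn_gt0 // ler_pM2r //.
  by rewrite ler_pdivlMr.
move=> bc; exists s => //; have tE' : (a + s * b) ^+ e.+2 = a ^+ e.+1 * (c * s).
  by rewrite tE bc mulfK // gt_eqF.
have eq_p : a ^+ e.+1 * p.[s] = a ^+ e.+1 * (c * s).
  by apply/eqP; rewrite eq_le mid andbT -tE'.
split=> //; last by rewrite eq_p tE'.
by apply: (mulfI _ eq_p); rewrite expf_neq0 // gt_eqF.
Qed.

End CapacityStep.

(** * Equality in AM-GM for determinants *)

Section DefiniteExtra.
Variables (K : numClosedFieldType) (n : nat).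
Implicit Types (A B H : 'M[K]_n) (v : 'cV[K]_n) (X : 'I_n -> 'M[K]_n) (S : {set 'I_n}).

(** AM-GM for the eigenvalues. *)
Lemma psd_det_AGM A : (0 < n)%N -> psd A ->
  \det A <= (\tr A / n%:R) ^+ n ?= iff (A == (\tr A / n%:R)%:M).
Proof.
move=> n0 pA; have [P [d [uP AE dP]]] := spectral_decomposition (proj1 pA).
have P'P : P ^t* *m P = 1%:M by rewrite -invmx_unitary // mulVmx // unitarymx_unit.
have PP : P *m P ^t* = 1%:M by apply/unitarymxP.
have detE : \det A = \prod_j d 0 j by rewrite AE spectral_det.
have trE : \tr A = \sum_j d 0 j.
  by rewrite AE mxtrace_mulC mulmxA PP mul1mx mxtrace_diag.
have := leif_AGM (A := predT) (E := d 0).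
rewrite card_ord -trE -detE => agm.
have {agm} : \det A <= (\tr A / n%:R) ^+ n ?= iff [forall i in predT, forall j in
  predT, d 0 i == d 0 j].
  by apply: agm => j _; rewrite (dP j).2 (proj2 pA).
congr (_ <= _ ?= iff _); apply/idP/eqP => [/forall_inP eqd|scal].
  suff dE : d = const_mx (\tr A / n%:R).
    by rewrite {1}AE dE diag_const_mx mul_mx_scalar -scalemxAl P'P scalemx1.
  apply/rowP => j; rewrite mxE trE (eq_bigr (fun=> d 0 j)).
    by rewrite sumr_const card_ord -[d 0 j *+ n]mulr_natr mulfK // pnatr_eq0 -lt0n.
  by move=> i _; apply/eqP; have /forall_inP := eqd i isT; exact.
have dE j : d 0 j = \tr A / n%:R.
  have : (P *m A *m P ^t*) j j = \tr A / n%:R.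
    by rewrite {1}scal mul_mx_scalar -scalemxAl PP scalemx1 mxE eqxx.
  by rewrite {1}AE !mulmxA PP mul1mx -mulmxA PP mulmx1 mxE eqxx.
by apply/forall_inP => i _; apply/forall_inP => j _; rewrite !dE.
Qed.

Lemma psd_congr A B : psd A -> psd (B *m A *m B ^t*).
Proof.
case=> /hermP hA pA; split.
  have AE : A = A ^t* by apply/matrixP => i j; rewrite !mxE hA.
  have E : (B *m A *m B ^t*) ^t* = B *m A *m B ^t*.
    by rewrite trmx_mul map_mxM trmxCK trmx_mul map_mxM -AE mulmxA.
  by apply/hermP => i j; rewrite -{1}E !mxE.
move=> v; have := pA (B ^t* *m v).
by rewrite /qform trmx_mul map_mxM trmxCK !mulmxA.
Qed.

Lemma psd_whiten A : psd A -> \det A != 0 ->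
  exists2 B, B \in unitmx & B *m A *m B ^t* = 1%:M.
Proof.
move=> pA dA; have [P [d [uP AE dP]]] := spectral_decomposition (proj1 pA).
have PP : P *m P ^t* = 1%:M by apply/unitarymxP.
have d0 j : 0 < d 0 j.
  rewrite lt_def (dP j).2 (proj2 pA) andbT -(dP j).2.
  by apply: contraNneq dA => dj; rewrite AE spectral_det // (bigD1 j) //= dj mul0r.
pose r := \row_j (sqrtC (d 0 j))^-1 : 'rV[K]_n.
have rE : diag_mx r *m diag_mx d *m (diag_mx r) ^t* = 1%:M.
  rewrite tr_diag_mx map_diag_mx !mulmx_diag -diag_const_mx; congr diag_mx.
  apply/rowP => j; rewrite !mxE.
  have rj : (sqrtC (d 0 j))^-1 ^* = (sqrtC (d 0 j))^-1.
    by rewrite conj_Creal // rpredV ger0_real // sqrtC_ge0 ltW.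
  rewrite [X in _ * X]rj.
  by rewrite -{2}[d 0 j]sqrtCK expr2; field; rewrite sqrtC_eq0 gt_eqF.
have BE : diag_mx r *m P *m A *m (diag_mx r *m P) ^t* = 1%:M.
  rewrite trmx_mul map_mxM AE !mulmxA -[_ *m P *m P ^t*]mulmxA PP mulmx1.
  by rewrite -[_ *m P *m P ^t*]mulmxA PP mulmx1.
exists (diag_mx r *m P) => //.
by move: BE; rewrite -mulmxA => /mulmx1_unit[].
Qed.

Lemma psd_det_pd A : psd A -> \det A != 0 -> pd A.
Proof.
move=> pA dA; split=> [|v v0]; first exact: (proj1 pA).
have [B uB BE] := psd_whiten pA dA.
have uB' : B ^t* \in unitmx by rewrite map_unitmx unitmx_tr.
pose u := invmx (B ^t*) *m v.
have vE : v = B ^t* *m u by rewrite /u mulKVmx.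
have u0 : u != 0 by apply: contraNneq v0 => u0; rewrite vE u0 mulmx0.
have -> : qform A v = qform 1%:M u.
  by rewrite /qform -BE vE trmx_mul map_mxM trmxCK !mulmxA.
exact: qform1_gt0.
Qed.

(** Whitening turns A into 1 and H into some G. The hypothesis then says that
    the determinant of 1 + s G is the n-th power of its normalized trace,
    which makes G scalar. *)
Lemma det_tangent_eq A H (s : K) : (0 < n)%N -> psd A -> \det A != 0 -> psd H -> 0 < s ->
    \det A ^+ n.-1 * \det (A + s *: H) =
      (\det A + s * (n%:R^-1 * \tr (\adj A *m H))) ^+ n ->
  exists2 b, 0 <= b & H = b *: A.
Proof.
move=> n0 pA dA pH s0 eqAH; have [B uB BE] := psd_whiten pA dA.
have uB' : B ^t* \in unitmx by rewrite map_unitmx unitmx_tr.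
pose G := B *m H *m B ^t*.
have pG : psd G by exact: psd_congr.
have uA : A \in unitmx by rewrite unitmxE unitfE.
have AV : invmx A = B ^t* *m B.
  have /mulmx1C E : B *m (A *m B ^t*) = 1%:M by rewrite mulmxA.
  by rewrite -[LHS]mulmx1 -(mulmx1C (_ : (B ^t* *m B) *m A = 1%:M)) ?mulKmx // -mulmxA
    mulmx1C // -mulmxA.
have trG : \tr G = \tr (invmx A *m H) by rewrite /G mxtrace_mulC mulmxA AV.
have adjA : \adj A = \det A *: invmx A.
  by rewrite /invmx uA scalerA divff // scale1r.
have GE : B *m (A + s *: H) *m B ^t* = 1%:M + s *: G.
  by rewrite mulmxDr mulmxDl BE -scalemxAr -scalemxAl.
have detB : \det B * \det (B ^t*) = (\det A)^-1.
  by apply: (mulIf dA); rewrite mulVf // mulrAC -!det_mulmx BE det1.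
have {}e : \det (1%:M + s *: G) = (1 + s * (\tr G / n%:R)) ^+ n.
  rewrite -GE !det_mulmx mulrAC detB mulrC; apply: (mulfI (expf_neq0 n dA)).
  rewrite -exprMn (_ : \det A ^+ n = \det A ^+ n.-1 * \det A);
    last by rewrite -exprSr prednK.
  rewrite -mulrA [\det A * _]mulrCA divff // mulr1.
  rewrite eqAH adjA -scalemxAl mxtraceZ -trG; congr (_ ^+ n).
  by rewrite mulrDr mulr1; congr (_ + _); ring.
have pM : psd (1%:M + s *: G) by apply: psdD (pd_psd (pd1 _ _)) (psdZ (ltW s0) pG).
have trM : \tr (1%:M + s *: G) / n%:R = 1 + s * (\tr G / n%:R).
  by rewrite mxtraceD mxtraceZ mxtrace1 mulrDl divff ?mulrA // pnatr_eq0 -lt0n.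
have /eqP ME : 1%:M + s *: G == (1 + s * (\tr G / n%:R))%:M.
  by have [_] := psd_det_AGM n0 pM; rewrite trM e eqxx => <-.
pose b := \tr G / n%:R.
have GE1 : G = b *: 1%:M.
  apply: (scalerI (lt0r_neq0 s0)); apply: (addrI 1%:M).
  by rewrite ME -/b raddfD /= scalemx1 scale_scalar_mx.
exists b.
  pose v : 'cV[K]_n := delta_mx (Ordinal n0) 0.
  have v0 : v != 0.
    by apply/eqP => /matrixP/(_ (Ordinal n0) 0); rewrite !mxE !eqxx => /eqP;
      rewrite oner_eq0.
  by have := (proj2 pG) v; rewrite GE1 qformZ pmulr_lge0 // qform1_gt0.
apply: (can_inj (mulKmx uB)); apply: (can_inj (mulmxK uB')).
by rewrite -scalemxAr -scalemxAl BE -GE1.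
Qed.

End DefiniteExtra.

(** * Averaging two entries *)

Lemma sqr_sum_le (K : numClosedFieldType) (I : finType) (x : I -> K) : (forall i, 0 <=
  x i) ->
  (\sum_i x i) ^+ 2 <= #|I|%:R * \sum_i x i ^+ 2.
Proof.
move=> x0; have : 0 <= \sum_i \sum_j (x i - x j) ^+ 2.
  apply: sumr_ge0 => i _; apply: sumr_ge0 => j _.
  by rewrite real_exprn_even_ge0 // rpredB ?ger0_real.
have -> : \sum_i \sum_j (x i - x j) ^+ 2 =
    (#|I|%:R * \sum_i x i ^+ 2 - (\sum_i x i) ^+ 2) *+ 2.
  transitivity (\sum_i \sum_j (x i ^+ 2 + x j ^+ 2 - (x i * x j) *+ 2)).
    by apply: eq_bigr => i _; apply: eq_bigr => j _; ring.
  under eq_bigr => i _ do rewrite sumrB big_split /= sumr_const sumrMnl -mulr_sumr.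
  rewrite sumrB big_split /= sumr_const !sumrMnl -mulr_suml mulr_natl.
  by rewrite mulrnBl expr2 [in RHS]mulr2n.
by rewrite pmulrn_lge0 // subr_ge0.
Qed.

Section Averaging.
Variables (K : numClosedFieldType) (n : nat).
Implicit Types (A B D U V W : 'M[K]_n) (X Z : 'I_n -> 'M[K]_n) (i j k : 'I_n) (c : K).

Lemma pdet_slot X k c U V :
  pdet (fun i => if i == k then c *: U + V else X i) =
  c * pdet (fun i => if i == k then U else X i) +
      pdet (fun i => if i == k then V else X i).
Proof.
rewrite !pdetE mulr_sumr -big_split; apply: eq_bigr => s _ /=.
rewrite mulr_sumr -big_split; apply: eq_bigr => t _ /=.
rewrite mulrCA -mulrDr; congr (_ * _).
have E (Y : 'M[K]_n) : \prod_j (if s j == k then Y else X (s j)) (t j) j =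
   Y (t (s^-1%g k)) (s^-1%g k) * \prod_(j | j != s^-1%g k) X (s j) (t j) j.
  rewrite (bigD1 (s^-1%g k)) //= permKV eqxx; congr (_ * _); apply: eq_bigr => j jk.
  by rewrite -(inj_eq (@perm_inj _ s^-1%g)) permK (negbTE jk).
by rewrite !E !mxE mulrDl mulrA.
Qed.

Definition pair_upd X i j U V k := if k == i then U else if k == j then V else X k.

Lemma pair_updC X i j U V : i != j -> pdet (pair_upd X i j U V) = pdet (pair_upd X i j V U).
Proof.
move=> ij; apply: (pdet_swap (j := i) (k := j)); rewrite /pair_upd.
- by rewrite !eqxx [j == i]eq_sym (negbTE ij).
- by rewrite !eqxx [j == i]eq_sym (negbTE ij).
- by move=> k /negbTE -> /negbTE ->.
Qed.

(** In the slots i and j, X holds A + D and A - D; the mixed terms cancel by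
    symmetry. *)
Lemma pdet_average X i j : i != j ->
  let A := 2^-1 *: (X i + X j) in let D := 2^-1 *: (X i - X j) in
  pdet (pair_upd X i j A A) = pdet X + pdet (pair_upd X i j D D).
Proof.
move=> ij A D.
have lin1 c U V W : pdet (pair_upd X i j (c *: U + V) W) =
   c * pdet (pair_upd X i j U W) + pdet (pair_upd X i j V W).
  exact: pdet_slot.
have lin2 c U V W : pdet (pair_upd X i j W (c *: U + V)) =
   c * pdet (pair_upd X i j W U) + pdet (pair_upd X i j W V).
  by rewrite !(pair_updC _ W) // lin1.
have -> : pdet X = pdet (pair_upd X i j (1 *: D + A) (-1 *: D + A)).
  apply: eq_pdet => k; rewrite /pair_upd.
  case: eqP => [->|_]; last case: eqP => [->|//]; apply/matrixP => p q; rewrite !mxE;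
    by field.
rewrite lin1 !lin2 (pair_updC X A D ij); ring.
Qed.

Lemma poly_eq0_horner (p : {poly K}) : (forall w, p.[w] = 0) -> p = 0.
Proof.
move=> p0; apply/eqP; apply: contraT => pn0.
have := max_poly_roots pn0 (rs := [seq m%:R | m <- iota 0 (size p)]).
rewrite size_map size_iota ltnn; apply.
  by apply/allP => w _; rewrite /root p0.
rewrite map_inj_in_uniq ?iota_uniq // => a b _ _ /eqP.
by rewrite eqr_nat => /eqP.
Qed.

Lemma pair_upd_pfill D i j : i != j ->
  pdet (pair_upd (fun=> 1%:M) i j D D) = pfill (fun=> D) (setT :\ i :\ j) 1%:M.
Proof.
move=> ij; apply: eq_pdet => k; rewrite /pair_upd !inE.
by case: (k == i); case: (k == j).
Qed.

(** Put D into the slot i and M = 1 + w D into the others; the value is q(w) =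
    (n-1)! tr (adj M D). Since adj M M = det M and tr D = 0, one has q(w) = -
    w (n-1)! tr (adj M D^2), and comparing the coefficients of w gives the
    claim. *)
Lemma pdet_pair_traceless D i j : i != j -> \tr D = 0 ->
  pdet (pair_upd (fun=> 1%:M) i j D D) = - (n.-2`!%:R * \tr (D *m D)).
Proof.
move=> ij D0; rewrite pair_upd_pfill //.
pose S : {set 'I_n} := setT :\ i.
have cS : #|S| = n.-1 by rewrite /S setTD cardsC1 card_ord.
have jS : j \in S by rewrite !inE eq_sym ij.
pose Q := pfill_pencil (fun=> D) S D 1%:M.
pose R := pfill_pencil (fun=> D *m D) S D 1%:M.
have fillE W w : pfill (fun=> W) S (1%:M + w *: D) =
   n.-1`!%:R * \tr (\adj (1%:M + w *: D) *m W).
  rewrite -(pdet_adj i); apply: eq_pdet => k; rewrite !inE.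
  by case: eqP.
have QR : Q + 'X * R = 0.
  apply: poly_eq0_horner => w; rewrite hornerD hornerM hornerX !horner_pfill_pencil !fillE.
  rewrite mulrCA -mulrDr -mxtraceZ -mxtraceD.
  have -> : \adj (1%:M + w *: D) *m D + w *: (\adj (1%:M + w *: D) *m (D *m D)) =
     \det (1%:M + w *: D) *: D.
    rewrite -[\det _ *: D]mul_scalar_mx -mul_adj_mx -mulmxA mulmxDl mul1mx mulmxDr.
    by rewrite -scalemxAl -scalemxAr.
  by rewrite mxtraceZ D0 !mulr0.
have := congr1 (fun p : {poly K} => p`_1) QR.
have Q1 : Q`_1 = #|S|%:R * pfill (fun=> D) (S :\ j) 1%:M.
  exact: (coef1_pfill_pencil (fun=> D) 1%:M jS).
rewrite coefD coefXM /= coef0 coef0_pfill_pencil Q1 cS.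
have -> : pfill (fun=> D *m D) S 1%:M = n.-1`!%:R * \tr (D *m D).
  by have := fillE (D *m D) 0; rewrite scale0r addr0 adj1 mul1mx.
have n1 : (0 < n.-1)%N by rewrite -cS; apply/card_gt0P; exists j.
rewrite -{2}(prednK n1) factS prednK // natrM -mulrA -mulrDr => /eqP.
by rewrite mulf_eq0 pnatr_eq0 eqn0Ngt n1 /= addr_eq0 => /eqP.
Qed.

Definition mxnorm1 A : K := \sum_p \sum_q `|A p q|.

Lemma mxnorm1_ge0 A : 0 <= mxnorm1 A.
Proof. by apply: sumr_ge0 => p _; apply: sumr_ge0. Qed.

Lemma mxnorm1_ge A p q : `|A p q| <= mxnorm1 A.
Proof.
rewrite /mxnorm1 (bigD1 p) //= (bigD1 q) //= -addrA lerDl addr_ge0 //.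
  by apply: sumr_ge0.
by apply: sumr_ge0 => r _; apply: sumr_ge0.
Qed.

Lemma norm_pdet_le X : `|pdet X| <= (n`! ^ 2)%:R * \prod_i mxnorm1 (X i).
Proof.
rewrite pdetE; apply: le_trans (_ : _ <= \sum_(s : 'S_n) \sum_(t : 'S_n) \prod_i
  mxnorm1 (X i)) _.
  apply: le_trans (ler_norm_sum _ _ _) _; apply: ler_sum => s _.
  apply: le_trans (ler_norm_sum _ _ _) _; apply: ler_sum => t _.
  rewrite normrM normrX normrN1 expr1n mul1r normr_prod.
  rewrite [leRHS](reindex_inj (@perm_inj _ s)); apply: ler_prod => j _.
  by rewrite normr_ge0 mxnorm1_ge.
by rewrite !sumr_const card_Sn -mulrnA mulr_natl.
Qed.

Lemma hermitian_trace_sqr D : D \is hermsymmx ->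
  \tr (D *m D) = \sum_p \sum_q `|D p q| ^+ 2.
Proof.
move=> /hermP hD; apply: eq_bigr => p _; rewrite mxE.
by apply: eq_bigr => q _; rewrite normCK -hD.
Qed.

Lemma hermitian_trace_sqr_gt0 D : D \is hermsymmx -> D != 0 -> 0 < \tr (D *m D).
Proof.
move=> hD; rewrite hermitian_trace_sqr // pair_bigA /= => D0.
rewrite lt_def sumr_ge0 ?andbT => [|[p q] _]; last by rewrite exprn_ge0.
apply: contraNneq D0 => /psumr_eq0P z; apply/eqP/matrixP => p q; rewrite mxE.
apply/eqP; rewrite -normr_eq0 -sqrf_eq0 (z _ (p, q)) //.
by move=> [a b] _; rewrite exprn_ge0.
Qed.

Lemma sqr_mxnorm1_le D : D \is hermsymmx ->
  mxnorm1 D ^+ 2 <= (n ^ 2)%:R * \tr (D *m D).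
Proof.
move=> hD; rewrite hermitian_trace_sqr // /mxnorm1 !pair_bigA /=.
apply: le_trans (sqr_sum_le _) _ => //.
by rewrite card_prod !card_ord expnS expn1.
Qed.

Lemma pdet_pair_traceless_scalar D i j : i != j -> \tr D = 0 ->
  pdet (pair_upd (fun=> n%:R^-1%:M) i j D D) =
    - ((n.-2`! * n ^ 2)%:R / n%:R ^+ n * \tr (D *m D)).
Proof.
move=> ij D0; have n0 : n%:R != 0 :> K by rewrite pnatr_eq0 -lt0n;
  case: (n) i {ij} => [[]|].
transitivity (pdet (fun k => n%:R^-1 *: pair_upd (fun=> 1%:M) i j (n%:R *: D) (n%:R *:
  D) k)).
  apply: eq_pdet => k; rewrite /pair_upd.
  by case: eqP => _; [|case: eqP => _]; rewrite ?scalerK // scalemx1.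
rewrite pdet_scale prodr_const card_ord pdet_pair_traceless ?mxtraceZ ?D0 ?mulr0 //.
rewrite -scalemxAl -scalemxAr !mxtraceZ natrM natrX exprVn.
have := expf_neq0 n n0; move: (n%:R ^+ n : K) => y y0.
by field.
Qed.

(** In the intended use the value is the difference of two mixed discriminants
    of semidefinite tuples, and this is why it is real. *)
Definition negative_radius (rho : K) :=
  forall X i j D, i != j -> (forall k, mxnorm1 (X k - n%:R^-1%:M) <= rho) ->
    D \is hermsymmx -> \tr D = 0 -> pdet (pair_upd X i j D D) \is Num.real ->
    D != 0 -> pdet (pair_upd X i j D D) < 0.

(** Expand around 1/n. The main term is - kap tr (D^2). Each of the fewer than
    2^n other terms has a factor of norm at most rho, and the two occurrences
    of D are bounded by a multiple of tr (D^2); the choice of rho keeps the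
    sum of these terms below kap tr (D^2). *)
Lemma near_scalar_pair_negative : exists2 rho : K, 0 < rho & negative_radius rho.
Proof.
pose kap : K := (n.-2`! * n ^ 2)%:R / n%:R ^+ n.
pose L : K := (2 ^ n * n`! ^ 2 * n ^ 2)%:R.
have [n0|n0] := posnP n.
  by exists 1; rewrite ?ltr01 // => X i; have := leq_trans (ltn_ord i) (eq_leq n0).
have nK : 0 < n%:R :> K by rewrite ltr0n.
have kap0 : 0 < kap.
  by rewrite divr_gt0 ?exprn_gt0 // ltr0n muln_gt0 fact_gt0 expn_gt0 n0.
have L0 : 0 < L by rewrite ltr0n !muln_gt0 !expn_gt0 fact_gt0 n0.
pose rho := kap / (L + kap).
have Lk : 0 < L + kap by rewrite addr_gt0.
have rho0 : 0 < rho by rewrite divr_gt0.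
have rho1 : rho <= 1 by rewrite ler_pdivrMr // mul1r lerDr ltW.
have rhoL : rho * L < kap.
  by rewrite mulrAC ltr_pdivrMr // ltr_pM2l // ltrDl.
exists rho => // X i j D ij Xr hD D0 rX Dn0.
pose E k := X k - n%:R^-1%:M.
pose U := pair_upd E i j 0 0.
pose V := pair_upd (fun=> n%:R^-1%:M) i j D D.
have XUV : pdet (pair_upd X i j D D) = pdet (fun k => U k + V k).
  apply: eq_pdet => k; rewrite /U /V /pair_upd /E.
  by case: eqP => _; [|case: eqP => _]; rewrite ?add0r ?subrK.
pose F (T : {set 'I_n}) : K := pdet (fun k => if k \in T then U k else V k).
have F0 : F set0 = - (kap * \tr (D *m D)).
  rewrite -(pdet_pair_traceless_scalar ij) //; apply: eq_pdet => k.
  by rewrite inE.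
have normF T : T != set0 -> `|F T| <= (n`! ^ 2)%:R * (rho * mxnorm1 D ^+ 2).
  case/set0Pn => k kT.
  have rhs0 : 0 <= (n`! ^ 2)%:R * (rho * mxnorm1 D ^+ 2).
    by rewrite mulr_ge0 ?ler0n // mulr_ge0 ?exprn_ge0 ?mxnorm1_ge0 // ltW.
  case: (boolP ((k == i) || (k == j))) => [kij|].
    rewrite /F (@pdet0 _ _ _ k) ?normr0 // kT /U /pair_upd.
    by case: (k == i) kij => //= ->.
  rewrite negb_or => /andP[ki kj].
  apply: le_trans (norm_pdet_le _) _; rewrite ler_pM2l ?ltr0n ?expn_gt0 ?fact_gt0 //.
  pose g l := if (l == i) || (l == j) then mxnorm1 D else if l == k then rho else 1.
  have gE : \prod_l g l = rho * mxnorm1 D ^+ 2.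
    rewrite (bigD1 i) //= (bigD1 j) 1?eq_sym //= (bigD1 k) /=; last by rewrite ki kj.
    rewrite big1 => [|l /andP[/andP[/negbTE li /negbTE lj] /negbTE lk]]; last first.
      by rewrite /g li lj lk.
    rewrite /g !eqxx orbT /= (negbTE ki) (negbTE kj) /= mulr1; ring.
  rewrite -gE; apply: ler_prod => l _; rewrite mxnorm1_ge0 /=.
  have m0 : mxnorm1 0 = 0.
    by rewrite /mxnorm1 big1 // => p _; rewrite big1 // => q _; rewrite mxE normr0.
  have m1 : mxnorm1 n%:R^-1%:M = 1.
    rewrite /mxnorm1 (eq_bigr (fun=> n%:R^-1)) => [|p _].
      by rewrite sumr_const card_ord -[_ *+ n]mulr_natr mulVf // gt_eqF.
    rewrite (bigD1 p) //= big1 => [|q /negbTE qp]; rewrite mxE.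
      by rewrite eqxx addr0 ger0_norm // invr_ge0 ler0n.
    by rewrite eq_sym qp normr0.
  rewrite /g /U /V /pair_upd; case: (l == i) => /=.
    by case: ifP => _; rewrite ?m0 ?mxnorm1_ge0.
  case: (l == j) => /=; first by case: ifP => _; rewrite ?m0 ?mxnorm1_ge0.
  case: eqP => [->|_]; first by rewrite kT Xr.
  by case: ifP => _; rewrite ?m1 // (le_trans (Xr l)).
pose err := \sum_(T | T != set0) F T.
have pE : pdet (pair_upd X i j D D) = - (kap * \tr (D *m D)) + err.
  by rewrite XUV pdetD (bigD1 set0) //= -/(F _) F0.
have normerr : `|err| <= (2 ^ n)%:R * ((n`! ^ 2)%:R * (rho * mxnorm1 D ^+ 2)).
  apply: le_trans (ler_norm_sum _ _ _) _.
  apply: le_trans (_ : _ <= \sum_(T : {set 'I_n} | T != set0) (n`! ^ 2)%:R * (rho *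
    mxnorm1 D ^+ 2)) _.
    by apply: ler_sum => T; exact: normF.
  rewrite sumr_const -[_ *+ _]mulr_natl ler_wpM2r //.
    by rewrite mulr_ge0 ?ler0n // mulr_ge0 ?exprn_ge0 ?mxnorm1_ge0 // ltW.
  rewrite ler_nat (leq_trans (max_card _)) // -cardsT -powersetT.
  by rewrite card_powerset cardsT card_ord.
have rerr : err \is Num.real.
  have -> : err = pdet (pair_upd X i j D D) + kap * \tr (D *m D) by rewrite pE addrAC
    addNr add0r.
  rewrite rpredD // rpredM //; first exact: gtr0_real.
  exact/gtr0_real/hermitian_trace_sqr_gt0.
have tr0 := hermitian_trace_sqr_gt0 hD Dn0.
rewrite pE addrC subr_lt0; apply: le_lt_trans (real_ler_norm rerr) _.
apply: le_lt_trans normerr _.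
apply: le_lt_trans (_ : _ <= rho * L * \tr (D *m D)) _; last by rewrite ltr_pM2r.
have -> : rho * L * \tr (D *m D) =
    (2 ^ n)%:R * ((n`! ^ 2)%:R * (rho * ((n ^ 2)%:R * \tr (D *m D)))).
  by rewrite /L natrM natrM; ring.
rewrite ler_wpM2l ?ler0n // ler_wpM2l ?ler0n //.
by rewrite ler_pM2l // sqr_mxnorm1_le.
Qed.

End Averaging.

Local Open Scope complex_scope.

(** * The determinant of a combination of a doubly stochastic tuple *)

Section Capacity.
Import all_classical all_reals all_analysis.
Variable R : realType.

(** Sum the inequality ln x <= x - 1 at x = t_i / l_j with the weights w i j;
    the right-hand sides add up to 0. Equality forces x = 1 wherever the
    weight is positive. *)
Lemma weighted_AGM (I : finType) (w : I -> I -> R) (t : I -> R) :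
    (forall i, 0 < t i) -> (forall i j, 0 <= w i j) ->
    (forall j, \sum_i w i j = 1) -> (forall i, \sum_j w i j = 1) ->
  let l j := \sum_i t i * w i j in
  \prod_i t i <= \prod_j l j /\
  (\prod_j l j = \prod_i t i -> forall i j, 0 < w i j -> t i = l j).
Proof.
move=> t0 w0 wc wr l.
have l0 j : 0 < l j.
  rewrite lt_def sumr_ge0 ?andbT => [|i _]; last by rewrite mulr_ge0 ?(ltW (t0 i)).
  apply/eqP => /psumr_eq0P lj0; have := wc j; rewrite big1 => [|i _].
    by move/esym/eqP; rewrite oner_eq0.
  have /eqP := lj0 (fun i _ => mulr_ge0 (ltW (t0 i)) (w0 i j)) i isT.
  by rewrite mulf_eq0 gt_eqF //= => /eqP.
have pE (F : I -> R) : (forall i, 0 < F i) -> \prod_i F i = expR (\sum_i ln (F i)).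
  by move=> F0; rewrite expR_sum; apply: eq_bigr => i _; rewrite lnK // posrE.
pose g i j := w i j * (t i / l j - 1 - ln (t i / l j)).
have g0 i j : 0 <= g i j.
  have tl : 0 < t i / l j by rewrite divr_gt0.
  rewrite mulr_ge0 // subr_ge0; have := @le_ln1Dx R (t i / l j - 1).
  by rewrite [1 + _]addrC subrK; apply; rewrite ltrBrDr addNr.
have gE : \sum_j ln (l j) - \sum_i ln (t i) = \sum_j \sum_i g i j.
  have -> : \sum_i ln (t i) = \sum_j \sum_i w i j * ln (t i).
    rewrite exchange_big; apply: eq_bigr => i _.
    by rewrite -mulr_suml wr mul1r.
  rewrite -sumrB; apply: eq_bigr => j _.
  transitivity (\sum_i w i j * ln (l j) - \sum_i w i j * ln (t i) + (\sum_i t i * w i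
    j) / l j - \sum_i w i j).
    by rewrite -/(l j) divff ?gt_eqF // wc addrK -mulr_suml wc mul1r.
  rewrite mulr_suml -sumrB -big_split -sumrB; apply: eq_bigr => i _ /=.
  by rewrite /g ln_div ?posrE //; ring.
rewrite !pE // ler_expR -subr_ge0 gE; split.
  by apply: sumr_ge0 => j _; apply: sumr_ge0.
move=> /expR_inj/eqP; rewrite -subr_eq0 gE psumr_eq0 => [/allP z|j _]; last exact: sumr_ge0.
move=> i j wij; apply/eqP; have := z j (mem_index_enum _).
rewrite /= psumr_eq0 => [/allP/(_ i (mem_index_enum _))|k _ //].
rewrite /= mulf_eq0 gt_eqF //= => gz; apply: contraT => tl.
have n0 : ln (t i / l j) != 0.
  rewrite ln_eq0 ?divr_gt0 //; apply: contra tl => /eqP e.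
  by rewrite (divr1_eq e).
have := expR_gt1Dx n0; rewrite lnK ?posrE ?divr_gt0 // addrC -ltrBrDr.
by rewrite -subr_gt0 (eqP gz) ltxx.
Qed.

Section DoublyStochastic.
Variable n : nat.
Local Notation K := R[i].
Variable X : 'I_n -> 'M[K]_n.
Hypotheses (pX : forall i, psd (X i)) (trX : forall i, \tr (X i) = 1)
  (sumX : \sum_i X i = 1%:M).

Let psd_comb (P : pred 'I_n) (t : 'I_n -> K) :
  (forall i, 0 < t i) -> psd (\sum_(i | P i) t i *: X i).
Proof. by move=> t0; apply: psd_sum => i _; apply: psdZ => //; exact: ltW. Qed.

(** In an orthonormal eigenbasis (u_j) of T, the numbers u_j^* X_i u_j form a
    doubly stochastic matrix, and the eigenvalues of T are the corresponding
    weighted means of t. If X_k is definite, its row has no zero, so equality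
    makes t_k the only eigenvalue. *)
Lemma capacity (t : 'I_n -> K) : (forall i, 0 < t i) ->
  \prod_i t i <= \det (\sum_i t i *: X i) /\
  (\det (\sum_i t i *: X i) = \prod_i t i ->
     forall k, pd (X k) -> \sum_i t i *: X i = (t k)%:M).
Proof.
move=> t0; set T := \sum_i _.
have pT : psd T by exact: psd_comb.
have [P [d [uP TE dP]]] := spectral_decomposition (proj1 pT).
pose u j := col j (P ^t*).
pose w i j : R := complex.Re (qform (X i) (u j)).
have wE i j : (w i j)%:C = qform (X i) (u j).
  by rewrite RRe_real // ger0_real // (proj2 (pX i)).
pose tau i : R := complex.Re (t i).
have tauE i : (tau i)%:C = t i by rewrite RRe_real // gtr0_real.
have qsum (F : 'I_n -> 'M[K]_n) v : qform (\sum_i F i) v = \sum_i qform (F i) v.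
  by rewrite /qform mulmx_sumr mulmx_suml summxE.
have PP : P *m P ^t* = 1%:M by apply/unitarymxP.
have P'P : P ^t* *m P = 1%:M by rewrite -invmx_unitary // mulVmx // unitarymx_unit.
have qE A j : qform A (u j) = (P *m A *m P ^t*) j j.
  rewrite /qform /u !colE trmx_mul map_mxM trmxCK trmx_delta map_delta_mx.
  have -> : delta_mx 0 j *m P *m A *m (P ^t* *m delta_mx j 0) =
    delta_mx 0 j *m (P *m A *m P ^t*) *m delta_mx j 0 :> 'M[K]_1 by rewrite !mulmxA.
  by rewrite -rowE -colE [LHS]mxE [LHS]mxE.
have wc j : \sum_i w i j = 1.
  apply: (@complexI R); rewrite rmorph_sum /= (eq_bigr _ (fun i _ => wE i j)).
  by rewrite -qsum sumX qE mulmx1 PP mxE eqxx.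
have wr i : \sum_j w i j = 1.
  apply: (@complexI R); rewrite rmorph_sum /= (eq_bigr _ (fun j _ => wE i j)).
  rewrite (eq_bigr _ (fun j _ => qE (X i) j)) -/(\tr _).
  by rewrite -mulmxA mxtrace_mulC -mulmxA P'P mulmx1 trX.
have w0 i j : 0 <= w i j by rewrite -ler0c wE (proj2 (pX i)).
have tau0 i : 0 < tau i by rewrite -ltcR tauE.
pose l j := \sum_i tau i * w i j.
have [le_l eq_l] : \prod_i tau i <= \prod_j l j /\
  (\prod_j l j = \prod_i tau i -> forall i j, 0 < w i j -> tau i = l j).
  exact: weighted_AGM.
have lE j : (l j)%:C = d 0 j.
  rewrite (dP j).2 qsum rmorph_sum /=; apply: eq_bigr => i _.
  by rewrite rmorphM /= tauE wE qformZ.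
have detE : \det T = (\prod_j l j)%:C.
  by rewrite TE spectral_det // rmorph_prod; apply: eq_bigr => j _; rewrite /= lE.
have prodE : \prod_i t i = (\prod_i tau i)%:C.
  by rewrite rmorph_prod; apply: eq_bigr => j _; rewrite /= tauE.
rewrite detE prodE lecR; split=> // /complexI/eq_l {}eq_l k pk.
rewrite TE; have -> : d = const_mx (t k).
  apply/rowP => j; rewrite mxE -lE -tauE (eq_l k j) //.
  by rewrite -ltcR wE (proj2 pk) // (dP j).1.
by rewrite diag_const_mx mul_mx_scalar -scalemxAl P'P scalemx1.
Qed.

End DoublyStochastic.

End Capacity.

(** * The minimum over tuples with sum 1 *)

Section Descent.
Variables (R : realType) (n : nat).
Local Notation K := R[i].
Variable X : 'I_n -> 'M[K]_n.
Hypotheses (pX : forall i, psd (X i)) (trX : forall i, \tr (X i) = 1)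
  (sumX : \sum_i X i = 1%:M).

Implicit Types (S : {set 'I_n}) (t u : 'I_n -> K) (k : 'I_n) (s : K).

(** The remaining part of the bound after the steps from degree n down to
    degree d; the factors e^e / e.+1^e.+1 of [capacity_step] telescope. For d
    = 0 the value is n! / n^n, since 0 ^+ 0 = 1. *)
Definition cap_bound (d : nat) : K := n`!%:R * (d%:R ^+ d / n%:R ^+ n).

Let comb (S : {set 'I_n}) (t : 'I_n -> K) := \sum_(i in S) t i *: X i.

Let psd_comb S t : (forall i, 0 < t i) -> psd (comb S t).
Proof. by move=> t0; apply: psd_sum => i _; apply: psdZ => //; exact: ltW. Qed.

Let nn_gt0 : 0 < n%:R ^+ n :> K.
Proof. by case: (n) => [|m]; rewrite ?expr0 ?ltr01 // exprn_gt0 // ltr0n. Qed.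

Let cap_bound_gt0 d : 0 < cap_bound d.
Proof.
rewrite mulr_gt0 ?ltr0n ?fact_gt0 // divr_gt0 //.
by case: d => [|m]; rewrite ?expr0 ?ltr01 // exprn_gt0 // ltr0n.
Qed.

Lemma cap_bound_step d :
  cap_bound d.+1 * (d%:R ^+ d / d.+1%:R ^+ d.+1) = cap_bound d.
Proof.
rewrite /cap_bound; have d0 : 0 < d.+1%:R ^+ d.+1 :> K by rewrite exprn_gt0 // ltr0n.
move: (d.+1%:R ^+ d.+1 : K) (d%:R ^+ d : K) (n%:R ^+ n : K) d0 nn_gt0 => x y z x0 z0.
by field; rewrite !gt_eqF.
Qed.

Let upd (t : 'I_n -> K) k s i := if i == k then s else t i.

Let comb_upd S t k s : k \notin S -> comb (k |: S) (upd t k s) = comb S t + s *: X k.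
Proof.
move=> kS; rewrite /comb big_setU1 //= addrC /upd eqxx; congr (_ + _).
by apply: eq_bigr => i iS; case: eqP => // ik; rewrite -ik iS in kS.
Qed.

Let prod_upd S t k s : k \notin S ->
  \prod_(i in k |: S) upd t k s i = s * \prod_(i in S) t i.
Proof.
move=> kS; rewrite big_setU1 //= /upd eqxx; congr (_ * _).
by apply: eq_bigr => i iS; case: eqP => // ik; rewrite -ik iS in kS.
Qed.

(** The polynomial of [capacity_step] is s |-> pfill X (k |: S) (A + s X_k). *)
Let descent_step S k (t : 'I_n -> K) : k \notin S -> (forall i, 0 < t i) ->
    (forall u : 'I_n -> K, (forall i, 0 < u i) ->
       cap_bound #|S|.+1 * \prod_(i in k |: S) u i <= pfill X (k |: S) (comb (k |: S) u)) ->
  let A := comb S t in let a := pfill X (k |: S) A in let b := pfill X S A in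
  let pt := \prod_(i in S) t i in
  cap_bound #|S| * pt <= b /\
  (b = cap_bound #|S| * pt -> exists2 s, 0 < s &
   [/\ pfill X (k |: S) (A + s *: X k) = cap_bound #|S|.+1 * (s * pt),
       a ^+ #|S| * pfill X (k |: S) (A + s *: X k) = (a + s * b) ^+ #|S|.+1
     & (0 < #|S|)%N -> 0 < a]).
Proof.
move=> kS t0 lower A a b pt.
have pA : psd A by exact: psd_comb.
have kS' : k \in k |: S by rewrite !inE eqxx.
have cS' : #|k |: S| = #|S|.+1 by rewrite cardsU1 kS.
have SE : (k |: S) :\ k = S by rewrite setU1K.
pose p := pfill_pencil X (k |: S) (X k) A.
have p0 : p`_0 = a by rewrite coef0_pfill_pencil.
have p1 : p`_1 = #|S|.+1%:R * b.
  by rewrite /p (coef1_pfill_pencil X A kS') cS' SE.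
have ps s : p.[s] = pfill X (k |: S) (A + s *: X k) by rewrite horner_pfill_pencil.
have pt0 : 0 < pt by rewrite prodr_gt0.
have := @capacity_step _ p #|S| b (cap_bound #|S|.+1 * pt) p1.
rewrite p0; case.
- exact: pfill_ge0.
- exact: pfill_ge0.
- by rewrite mulr_gt0.
- move=> /cards0_eq S0; rewrite /a /A /comb S0 big_set0; apply: (@pdet0 _ _ _ k).
  by rewrite !inE eqxx.
- move=> s s0; rewrite ps -comb_upd // -mulrA [pt * s]mulrC -(prod_upd t s kS);
  apply: lower.
  by move=> i; rewrite /upd; case: eqP.
- by move=> s s0; rewrite ps; have := pfill_tangent pX pA kS' s0; rewrite cS' SE.
rewrite mulrAC cap_bound_step => le_b eq_b; split=> // /eq_b[s s0].
by rewrite ps => -[e1 e2 e3]; exists s => //; split=> //; rewrite e1 -mulrA [pt * s]mulrC.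
Qed.

Lemma pfill_capacity S (t : 'I_n -> K) : (forall i, 0 < t i) ->
  cap_bound #|S| * \prod_(i in S) t i <= pfill X S (comb S t).
Proof.
move En : #|~: S| => m; elim: m S En t => [|m IH] S En t t0.
  have -> : S = setT by rewrite -[S]setCK (cards0_eq En) setC0.
  rewrite pfillT /comb cardsT card_ord /cap_bound divff ?gt_eqF // mulr1.
  rewrite ler_pM2l ?ltr0n ?fact_gt0 // (eq_bigl predT) => [|i]; last by rewrite inE.
  rewrite [X in \det X](eq_bigl predT) => [|i]; last by rewrite inE.
  exact: (proj1 (capacity pX trX sumX t0)).
have [k kS] : exists k, k \in ~: S by apply/card_gt0P; rewrite En.
rewrite inE in kS; apply: (proj1 (descent_step kS t0 _)) => u u0.
have <- : #|k |: S| = #|S|.+1 by rewrite cardsU1 kS.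
apply: IH => //.
by apply/eqP; rewrite -eqSS -En setCU setIC -setDE (cardsD1 k (~: S)) inE kS.
Qed.

Let pfill_capacityU S k : k \notin S -> forall u, (forall i, 0 < u i) ->
  cap_bound #|S|.+1 * \prod_(i in k |: S) u i <= pfill X (k |: S) (comb (k |: S) u).
Proof.
move=> kS u u0; have <- : #|k |: S| = #|S|.+1 by rewrite cardsU1 kS.
exact: pfill_capacity.
Qed.

Lemma pdet_lower_bound : cap_bound 0 <= pdet X.
Proof.
have := pfill_capacity set0 (fun=> ltr01); rewrite cards0 big_set0 mulr1.
by rewrite pfill0.
Qed.

Hypothesis extremal : pdet X = cap_bound 0.

(** Climbing back from the empty set: the value of s attained in each step
    becomes the coordinate of t at the index that enters S. *)
Let extremal_point S : exists2 t : 'I_n -> K, forall i, 0 < t i &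
  pfill X S (comb S t) = cap_bound #|S| * \prod_(i in S) t i.
Proof.
move En : #|S| => m; elim: m S En => [|m IH] S En.
  exists (fun=> 1); first by move=> i; exact: ltr01.
  by rewrite (cards0_eq En) pfill0 big_set0 mulr1.
have [k kS] : exists k, k \in S by apply/card_gt0P; rewrite En.
have kS' : k \notin S :\ k by rewrite !inE eqxx.
have Em : #|S :\ k| = m by apply/eqP; rewrite -eqSS -En (cardsD1 k S) kS.
have [t t0 tE] := IH _ Em; rewrite -Em in tE.
have [_ /(_ tE)[s s0 [sE _ _]]] := descent_step kS' t0 (pfill_capacityU kS').
exists (upd t k s); first by move=> i; rewrite /upd; case: eqP.
rewrite -{1 2}(setD1K kS) comb_upd // sE Em; congr (_ * _).
by rewrite -(prod_upd t s kS') setD1K.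
Qed.

(** Climb to the complement of k. The last step gives equality in the tangent
    bound for the determinant, so X_k is a multiple of A = sum_(i != k) t_i
    X_i and hence definite; it also gives equality in [capacity], so A + s X_k
    is scalar. *)
Lemma extremal_unique k : X k = n%:R^-1%:M.
Proof.
have n0 : (0 < n)%N by case: (n) k => [[]|].
have nK : n%:R != 0 :> K by rewrite pnatr_eq0 -lt0n.
have trace_scal (c : K) : X k = c%:M -> X k = n%:R^-1%:M.
  move=> XE; have := trX k; rewrite XE mxtrace_scalar => cn; congr _%:M.
  by apply: (mulIf nK); rewrite mulVf // mulr_natr.
have [n1|n2] := leqP n 1.
  apply: (trace_scal 1); rewrite -sumX (bigD1 k) //= big1 ?addr0 // => i.
  case/eqP; apply/val_inj; have := leq_trans (ltn_ord i) n1;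
    have := leq_trans (ltn_ord k) n1.
  by rewrite /= !ltnS !leqn0 => /eqP-> /eqP->.
pose S := ~: [set k].
have kS : k \notin S by rewrite !inE eqxx.
have cS : #|S| = n.-1 by rewrite cardsC1 card_ord.
have kST : k |: S = setT by rewrite /S setUCr.
have [t t0 tE] := extremal_point S.
have [_ /(_ tE)[s s0]] := descent_step kS t0 (pfill_capacityU kS).
rewrite kST cS (prednK n0) !pfillT; set A := comb S t.
have pA : psd A by exact: psd_comb.
have nf0 : 0 < n`!%:R :> K by rewrite ltr0n fact_gt0.
have bE : pfill X S A = n`!%:R * (n%:R^-1 * \tr (\adj A *m X k)).
  transitivity (pdet (fun i => if i == k then X k else A)).
    by apply: eq_pdet => i; rewrite !inE; case: eqP => [->|].
  rewrite pdet_adj mulrA; congr (_ * _).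
  by rewrite -{2}(prednK n0) factS natrM prednK // mulrAC divff ?mul1r.
rewrite bE => -[e1 e2 /(_ _)]; rewrite -ltnS (prednK n0) n2 => /(_ isT) dA.
have {}dA : \det A != 0 by apply: contraTneq dA => ->; rewrite mulr0 ltxx.
have [b b0 XE] : exists2 b, 0 <= b & X k = b *: A.
  apply: (det_tangent_eq n0 pA dA (pX k) s0).
  apply: (mulfI (expf_neq0 n (lt0r_neq0 nf0))).
  rewrite -exprMn mulrDr [n`!%:R * (s * _)]mulrCA -e2 exprMn mulrACA -exprSr.
  by rewrite prednK.
have bn0 : b != 0.
  apply: contraNneq (oner_neq0 K) => b_0; rewrite -(trX k) XE b_0 scale0r.
  by rewrite mxtrace0.
have pXk : pd (X k).
  by rewrite XE; apply: pdZ; [rewrite lt_def bn0|exact: psd_det_pd].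
have TE : \sum_i upd t k s i *: X i = A + s *: X k.
  by rewrite -comb_upd // kST /comb; apply: eq_bigl => i; rewrite inE.
have u0 i : 0 < upd t k s i by rewrite /upd; case: eqP.
have [_] := capacity pX trX sumX u0; rewrite TE => /(_ _ k pXk).
have -> : \det (A + s *: X k) = \prod_i upd t k s i.
  apply: (mulfI (lt0r_neq0 nf0)); rewrite e1 /cap_bound divff ?gt_eqF // mulr1.
  rewrite -(prod_upd t s kS) kST; congr (_ * _); apply: eq_bigl => i.
  by rewrite inE.
move=> /(_ erefl) TE'; rewrite XE in TE'.
have : (1 + s * b) *: A = s%:M by move: TE'; rewrite scalerDl scale1r scalerA /upd eqxx.
have sb : 1 + s * b != 0 by rewrite gt_eqF // ltr_pwDl ?ltr01 // mulr_ge0 // ltW.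
move/(canRL (scalerK sb)) => AE.
by apply: (trace_scal (b * ((1 + s * b)^-1 * s))); rewrite XE AE !scale_scalar_mx.
Qed.

End Descent.

(** * Tuples of semidefinite matrices of trace 1 *)

Section DensityTuples.
Variables (R : realType) (n : nat).
Hypothesis n_gt0 : (0 < n)%N.
Local Notation K := R[i].
Implicit Types (X : 'I_n -> 'M[K]_n) (C : 'M[K]_n).

Definition density X := forall i, psd (X i) /\ \tr (X i) = 1.

Lemma density_pdet_ge0 X : density X -> 0 <= pdet X.
Proof.
move=> dX; rewrite -(pfill0 X 0); apply: pfill_ge0; last exact: psd0.
by move=> i; exact: (proj1 (dX i)).
Qed.

Lemma density_sum X : density X -> psd (\sum_i X i) /\ \tr (\sum_i X i) = n%:R.
Proof.
move=> dX; split; first by apply: psd_sum => i _; exact: (proj1 (dX i)).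
rewrite raddf_sum /= (eq_bigr (fun=> 1)) => [|i _]; last exact: (proj2 (dX i)).
by rewrite sumr_const card_ord.
Qed.

Lemma density_scaled C : psd C -> \tr C = n%:R ->
  density (fun _ : 'I_n => n%:R^-1 *: C) /\ \sum_(i < n) n%:R^-1 *: C = C.
Proof.
move=> pC tC; have n0 : n%:R != 0 :> K by rewrite pnatr_eq0 -lt0n.
split=> [i|].
  split; first by apply: psdZ => //; rewrite invr_ge0 ler0n.
  by rewrite mxtraceZ tC mulVf.
by rewrite sumr_const card_ord -scaler_nat scalerA mulfV ?scale1r.
Qed.

Lemma all_equal_scaled X : (forall i j, X i = X j) ->
  X =1 fun=> n%:R^-1 *: \sum_i X i.
Proof.
move=> eqX k; rewrite (eq_bigr (fun=> X k)) // sumr_const card_ord -[X k *+ n]scaler_nat.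
by rewrite scalerA mulVf ?scale1r // pnatr_eq0 -lt0n.
Qed.

Lemma identity_minimum X : density X -> \sum_i X i = 1%:M ->
  pdet X <= pdet (fun _ : 'I_n => n%:R^-1 *: (1%:M : 'M[K]_n)) -> X =1 fun=> n%:R^-1%:M.
Proof.
move=> dX sX le_p k.
have pX i : psd (X i) by exact: (proj1 (dX i)).
have tX i : \tr (X i) = 1 by exact: (proj2 (dX i)).
apply: (extremal_unique pX tX sX); apply/eqP;
  rewrite eq_le (pdet_lower_bound pX tX sX) andbT.
apply: le_trans le_p _; rewrite pdet_const detZ det1 mulr1 /cap_bound expr0 mul1r exprVn.
exact: lexx.
Qed.

Lemma average_lt (rho : K) X i j :
    negative_radius n rho -> density X -> (forall k, mxnorm1 (X k - n%:R^-1%:M) <= rho)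
      -> X i != X j ->
  exists X', [/\ density X', \sum_k X' k = \sum_k X k & pdet X' < pdet X].
Proof.
move=> neg dX nX Xij; have ij : i != j by apply: contraNneq Xij => ->.
pose A := 2^-1 *: (X i + X j); pose D := 2^-1 *: (X i - X j).
have [pi ti] := dX i; have [pj tj] := dX j.
have two0 : 2 != 0 :> K by rewrite pnatr_eq0.
have dX' : density (pair_upd X i j A A).
  have dA : psd A /\ \tr A = 1.
    split; first by apply: psdZ; [rewrite invr_ge0 ler0n|exact: psdD].
    by rewrite mxtraceZ mxtraceD ti tj -[1 + 1]/(2%:R) mulVf.
  move=> k; rewrite /pair_upd; case: (k == i); first exact: dA.
  by case: (k == j); [exact: dA | exact: (dX k)].
have AA : A + A = X i + X j by rewrite -mulr2n -[A *+ 2]scaler_nat /A scalerA mulfV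
  ?scale1r.
have avg := pdet_average X ij; rewrite -/A -/D /= in avg.
exists (pair_upd X i j A A); split=> //.
  rewrite (bigD1 i) //= (bigD1 j) 1?eq_sym //= [in RHS](bigD1 i) //= [in RHS](bigD1 j)
    1?eq_sym //=.
  rewrite !addrA /pair_upd !eqxx [j == i]eq_sym (negbTE ij) AA; congr (_ + _).
  by apply: eq_bigr => k /andP[/negbTE -> /negbTE ->].
rewrite avg gtrDl; apply: neg => //.
- apply/hermP => p q; have [/hermP hi _] := pi; have [/hermP hj _] := pj.
  by rewrite !mxE rmorphM rmorphB /= -hi -hj conj_Creal // rpredV realn.
- by rewrite mxtraceZ raddfB /= ti tj subrr mulr0.
- have -> : pdet (pair_upd X i j D D) = pdet (pair_upd X i j A A) - pdet X.
    by apply/eqP; rewrite eq_sym subr_eq addrC; apply/eqP.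
  apply: rpredB; apply: ger0_real; exact: density_pdet_ge0.
- by rewrite scaler_eq0 invr_eq0 (negbTE two0) subr_eq0.
Qed.

Local Notation avg X := (fun _ : 'I_n => n%:R^-1 *: \sum_i X i).

Lemma pdet_avg X : pdet (avg X) = n`!%:R / n%:R ^+ n * \det (\sum_i X i).
Proof. by rewrite pdet_const detZ mulrA exprVn. Qed.

Lemma det_total_le1 X : density X -> \det (\sum_i X i) <= 1 /\
  (\det (\sum_i X i) = 1 -> \sum_i X i = 1%:M).
Proof.
move=> dX; have [pC tC] := density_sum dX.
have := psd_det_AGM n_gt0 pC; rewrite tC divff ?pnatr_eq0 -?lt0n // expr1n => -[le1 eq1].
by split=> // /eqP; rewrite eq1 => /eqP.
Qed.

Lemma det_eigenvalues C (c : 'rV[R]_n) : eigenvalue_vector C c ->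
  \det C = (\prod_i c 0 i)%:C.
Proof.
move=> eC; have := congr1 (fun p : {poly K} => p`_0) eC.
rewrite char_poly_det -horner_coef0 horner_prod.
under eq_bigr do rewrite hornerXsubC sub0r -mulN1r.
rewrite big_split /= prodr_const card_ord => /(mulfI (expf_neq0 _ _)) ->.
  by rewrite rmorph_prod.
by rewrite oppr_eq0 oner_eq0.
Qed.

Lemma feasibleE C X : feasible C X <-> density X /\ \sum_i X i = C.
Proof.
split=> [[pX tX sX]|[dX sX]].
  by split; first (move=> i; split; [exact: pX | exact: tX]).
split; last exact: sX.
  by move=> i; exact: (proj1 (dX i)).
by move=> i; exact: (proj2 (dX i)).
Qed.

(** The eigenvalues lie in [0, 1], so tr (A^2) <= tr A; and tr (A^2) is the
    sum of the squared moduli of the entries. *)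
Lemma density_entry_le1 (A : 'M[K]_n) p q : psd A -> \tr A = 1 -> `|A p q| <= 1.
Proof.
move=> pA trA; have [P [d [uP AE dP]]] := spectral_decomposition (proj1 pA).
have PP : P *m P ^t* = 1%:M by apply/unitarymxP.
have d0 j : 0 <= d 0 j by rewrite (dP j).2 (proj2 pA).
have trE : \sum_j d 0 j = 1.
  by rewrite -trA AE mxtrace_mulC mulmxA PP mul1mx mxtrace_diag.
have sqE : \tr (A *m A) = \sum_j d 0 j ^+ 2.
  have -> : A *m A = P ^t* *m (diag_mx d *m diag_mx d) *m P.
    rewrite {1 2}AE; move: (P ^t*) (diag_mx d) PP => Q E QP.
    by rewrite !mulmxA -[_ *m P *m Q]mulmxA QP mulmx1.
  rewrite mxtrace_mulC !mulmxA PP mul1mx mulmx_diag mxtrace_diag.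
  by apply: eq_bigr => j _; rewrite mxE expr2.
have sq1 : \tr (A *m A) <= 1.
  rewrite sqE -trE; apply: ler_sum => j _; rewrite expr2 ler_piMr // -trE (bigD1 j) //=.
  by rewrite lerDl sumr_ge0.
rewrite -(@expr_le1 _ 2) //; apply: le_trans sq1.
rewrite hermitian_trace_sqr ?(proj1 pA) // (bigD1 p) //= (bigD1 q) //= -addrA lerDl.
by rewrite addr_ge0 ?sumr_ge0 // => i _; rewrite ?exprn_ge0 // sumr_ge0 // => j _;
  rewrite exprn_ge0.
Qed.

End DensityTuples.

Section RealBounds.
Variable R : realType.
Local Notation K := R[i].

Lemma normc_Re_le (z : K) (c : R) : `|z| <= c%:C -> `|complex.Re z| <= c.
Proof. by move=> zc; rewrite -lecR (le_trans (normc_ge_Re z)). Qed.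

Lemma normc_Im_le (z : K) (c : R) : `|z| <= c%:C -> `|complex.Im z| <= c.
Proof.
move=> zc; rewrite -normrN -ReiNIm; apply: normc_Re_le.
by rewrite normrM complexiE normCi mulr1.
Qed.

Lemma normc_le_ReIm (z : K) : `|z| <= (`|complex.Re z| + `|complex.Im z|)%:C.
Proof.
have normR (a : R) : `|a%:C| = `|a|%:C.
  by rewrite normc_def /= expr0n addr0 sqrtr_sqr.
rewrite {1}[z]complexE (le_trans (ler_normD _ _)) //.
by rewrite normrM complexiE normCi mul1r rmorphD /= !normR.
Qed.

(** The Weierstrass product inequality, as c_j >= 1 - |c_j - 1|. *)
Lemma prod_ge_sum_dist (I : Type) (r : seq I) (c : I -> R) :
  (\sum_(j <- r) `|c j - 1| <= 1) -> 1 - \sum_(j <- r) `|c j - 1| <= \prod_(j <- r) c j.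
Proof.
elim: r => [|j r IH]; first by rewrite !big_nil subr0.
rewrite !big_cons => s1; have sr0 : 0 <= \sum_(j <- r) `|c j - 1| by apply: sumr_ge0.
have a0 := normr_ge0 (c j - 1).
have {}IH := IH (le_trans (ler_wpDl a0 (lexx _)) s1).
have cj : 1 - `|c j - 1| <= c j by rewrite lerBlDr -lerBlDl distrC ler_norm.
have h1 : 0 <= 1 - `|c j - 1| by rewrite subr_ge0 (le_trans _ s1) // lerDl.
have h2 : 0 <= 1 - \sum_(j <- r) `|c j - 1| by rewrite subr_ge0 (le_trans _ s1) // lerDr.
apply: le_trans (ler_pM h1 h2 cj IH).
by move: (\sum_(j <- r) _) (`|c j - 1|) sr0 a0 => b a b0 a0; nra.
Qed.

End RealBounds.

(** * Compactness *)

Section Compactness.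
Import all_classical all_reals all_analysis.
Import numFieldNormedType.Exports.
Local Open Scope classical_set_scope.
Variables (R : realType) (n : nat).
Local Notation K := R[i].
Local Notation coord := ('I_n * 'I_n * 'I_n * bool)%type.
Local Notation space := (prod_topology (fun _ : coord => R)).

(** Tuples of matrices are parametrized by their real coordinates, so that the
    tuples with bounded entries form a product of intervals. *)
Definition matrices_of (x : space) (i : 'I_n) : 'M[K]_n :=
  \matrix_(p, q) (x (i, p, q, true) +i* x (i, p, q, false)).

Definition coords_of (X : 'I_n -> 'M[K]_n) : space :=
  fun a => let: (i, p, q, b) := a in
    if b then complex.Re (X i p q) else complex.Im (X i p q).

Lemma coords_ofK X : matrices_of (coords_of X) =1 X.
Proof. by move=> i; apply/matrixP => p q; rewrite mxE /=; case: (X i p q). Qed.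

Definition ccont (f : space -> K) :=
  continuous (fun x => complex.Re (f x) : R^o) /\ continuous (fun x => complex.Im (f x)
    : R^o).

Lemma eq_ccont f g : f =1 g -> ccont f -> ccont g.
Proof. by move=> fg; rewrite (funext fg). Qed.

Lemma ccont_coord i p q : ccont (fun x => matrices_of x i p q).
Proof.
apply: (@eq_ccont (fun x => x (i, p, q, true) +i* x (i, p, q, false))).
  by move=> x; rewrite mxE.
split=> x /=; first exact: (@proj_continuous _ (fun _ : coord => R) (i, p, q, true)).
exact: (@proj_continuous _ (fun _ : coord => R) (i, p, q, false)).
Qed.

Lemma ccont_cst c : ccont (fun=> c).
Proof. by split=> x; exact: cst_continuous. Qed.

Lemma ccontD f g : ccont f -> ccont g -> ccont (fun x => f x + g x).
Proof.
move=> [f1 f2] [g1 g2]; split=> x.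
  have -> : (fun x => complex.Re (f x + g x) : R^o) =
      (fun x => complex.Re (f x) + complex.Re (g x)).
    by apply/funext => y; case: (f y) (g y) => a b [].
  exact: (continuousD (f1 x) (g1 x)).
have -> : (fun x => complex.Im (f x + g x) : R^o) =
    (fun x => complex.Im (f x) + complex.Im (g x)).
  by apply/funext => y; case: (f y) (g y) => a b [].
exact: (continuousD (f2 x) (g2 x)).
Qed.

Lemma ccontM f g : ccont f -> ccont g -> ccont (fun x => f x * g x).
Proof.
move=> [f1 f2] [g1 g2]; split=> x.
  have -> : (fun x => complex.Re (f x * g x) : R^o) =
     (fun x => complex.Re (f x) * complex.Re (g x) - complex.Im (f x) * complex.Im (g x)).
    by apply/funext => y; case: (f y) (g y) => a b [].
  exact: (continuousB (continuousM (f1 x) (g1 x)) (continuousM (f2 x) (g2 x))).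
have -> : (fun x => complex.Im (f x * g x) : R^o) =
   (fun x => complex.Re (f x) * complex.Im (g x) + complex.Im (f x) * complex.Re (g x)).
  by apply/funext => y; case: (f y) (g y) => a b [].
exact: (continuousD (continuousM (f1 x) (g2 x)) (continuousM (f2 x) (g1 x))).
Qed.

Lemma ccont_conj f : ccont f -> ccont (fun x => (f x)^*).
Proof.
move=> [f1 f2]; split=> x.
  have -> : (fun x => complex.Re (f x)^* : R^o) = (fun x => complex.Re (f x)) by
    apply/funext => y; case: (f y).
  exact: f1.
have -> : (fun x => complex.Im (f x)^* : R^o) = (fun x => - complex.Im (f x)) by
  apply/funext => y; case: (f y).
exact: (continuousN (f2 x)).
Qed.

Lemma ccont_sum (I : Type) (r : seq I) (P : pred I) (F : I -> space -> K) :
  (forall i, ccont (F i)) -> ccont (fun x => \sum_(i <- r | P i) F i x).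
Proof.
move=> FC; elim: r => [|i r IH].
  by apply: eq_ccont (ccont_cst 0) => x; rewrite big_nil.
case Pi: (P i); last by apply: eq_ccont IH => x; rewrite big_cons Pi.
by apply: eq_ccont (ccontD (FC i) IH) => x; rewrite big_cons Pi.
Qed.

Lemma ccont_prod (I : Type) (r : seq I) (P : pred I) (F : I -> space -> K) :
  (forall i, ccont (F i)) -> ccont (fun x => \prod_(i <- r | P i) F i x).
Proof.
move=> FC; elim: r => [|i r IH].
  by apply: eq_ccont (ccont_cst 1) => x; rewrite big_nil.
case Pi: (P i); last by apply: eq_ccont IH => x; rewrite big_cons Pi.
by apply: eq_ccont (ccontM (FC i) IH) => x; rewrite big_cons Pi.
Qed.

Lemma ccont_pdet (X : space -> 'I_n -> 'M[K]_n) :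
  (forall i p q, ccont (fun x => X x i p q)) -> ccont (fun x => pdet (X x)).
Proof.
move=> XC; apply: eq_ccont (fun x => esym (pdetE (X x))) _.
apply: ccont_sum => s; apply: ccont_sum => t.
by apply: ccontM; [exact: ccont_cst|exact: ccont_prod].
Qed.

Lemma closed_ccont_eq f g : ccont f -> ccont g -> closed [set x | f x = g x].
Proof.
move=> [f1 f2] [g1 g2].
have -> : [set x | f x = g x] =
    (fun x => complex.Re (f x) - complex.Re (g x)) @^-1` [set 0] `&`
    (fun x => complex.Im (f x) - complex.Im (g x)) @^-1` [set 0].
  apply/seteqP; split=> x /=; first by move=> ->; rewrite !subrr.
  move=> [/eqP + /eqP]; rewrite !subr_eq0.
  by case: (f x) (g x) => a b [c d] /= /eqP-> /eqP->.
apply: closedI; apply: closed_comp; try exact: closed_eq.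
  by move=> x _; exact: (continuousB (f1 x) (g1 x)).
by move=> x _; exact: (continuousB (f2 x) (g2 x)).
Qed.

Lemma closed_ccont_ge0 f : ccont f -> closed [set x | 0 <= f x].
Proof.
move=> [f1 f2].
have -> : [set x | 0 <= f x] =
    (fun x => complex.Re (f x) : R) @^-1` [set y | 0 <= y] `&`
    (fun x => complex.Im (f x) : R) @^-1` [set 0].
  apply/seteqP; split=> x /=; rewrite lecE /=; first by move=> /andP[/eqP].
  by move=> [-> ->]; rewrite eqxx.
apply: closedI; apply: closed_comp; try by move=> x _; [exact: f1|exact: f2].
- by move=> x _; exact: f1.
- exact: closed_ge.
- by move=> x _; exact: f2.
- exact: closed_eq.
Qed.

Lemma closed_density : closed [set x | density (matrices_of x)].
Proof.
have -> : [set x | density (matrices_of x)] =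
  \bigcap_(i in [set: 'I_n]) (
    \bigcap_(pq in [set: 'I_n * 'I_n]) [set x | matrices_of x i pq.1 pq.2 =
      (matrices_of x i pq.2 pq.1)^*] `&`
    \bigcap_(v in [set: 'cV[K]_n]) [set x | 0 <= qform (matrices_of x i) v] `&`
    [set x | \tr (matrices_of x i) = 1]).
  apply/seteqP; split=> x /=.
    by move=> dx i _; have [[/hermP h p] t] := dx i; split=> //; split=> [[a b] _|v _] //=.
  move=> dx i; have [[h p] t] := dx i I; split=> //; split=> [|v]; last exact: p.
  by apply/hermP => a b; exact: (h (a, b) I).
apply: closed_bigI => i _; apply: closedI; first apply: closedI.
- apply: closed_bigI => -[a b] _ /=; apply: closed_ccont_eq; first exact: ccont_coord.
  exact/ccont_conj/ccont_coord.
- apply: closed_bigI => v _; apply: closed_ccont_ge0.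
  have E x : \sum_q (\sum_p (v ^t*) 0 p * matrices_of x i p q) * v q 0 = qform
    (matrices_of x i) v.
    by rewrite /qform mxE; apply: eq_bigr => q _; rewrite mxE.
  apply: (eq_ccont E); apply: ccont_sum => q; apply: ccontM (ccont_cst _).
  by apply: ccont_sum => p; apply: ccontM (ccont_cst _) (ccont_coord _ _ _).
- by apply: closed_ccont_eq (ccont_cst _); apply: ccont_sum => p; exact: ccont_coord.
Qed.

Lemma compact_density (D : set space) : closed D -> D `<=` [set x | density
  (matrices_of x)] -> compact D.
Proof.
move=> cD DD; apply: (subclosed_compact cD).
  exact: (@tychonoff _ (fun=> R) (fun=> `[-1, 1]) (fun=> @segment_compact _ _ _)).
move=> x /DD dx [[[i p] q] b]; have [pX tX] := dx i.
have := density_entry_le1 p q pX tX; rewrite mxE => le1.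
rewrite /= in_itv /= -ler_norml; case: b.
  exact: (normc_Re_le le1).
exact: (normc_Im_le le1).
Qed.

Lemma density_EVT (D : set space) (f : space -> K) : ccont f -> closed D ->
    D `<=` [set x | density (matrices_of x)] -> D !=set0 ->
  exists2 x, D x & forall y, D y -> complex.Re (f x) <= complex.Re (f y).
Proof.
move=> [f1 _] cD DD D0.
have [|x xD xmin] := @compact_EVT_min _ R (fun x => complex.Re (f x)) D D0
  (compact_density cD DD).
  exact: continuous_subspaceT.
by exists x; [exact: set_mem|move=> y yD; apply: xmin; exact: mem_set].
Qed.

Definition deviation (x : space) : R :=
  \sum_k \sum_p \sum_q (`|complex.Re ((matrices_of x k - n%:R^-1%:M) p q)| +
                        `|complex.Im ((matrices_of x k - n%:R^-1%:M) p q)|).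

Lemma continuous_bigsum (I : Type) (r : seq I) (F : I -> space -> R^o) :
  (forall i, continuous (F i)) -> continuous (fun x => \sum_(i <- r) F i x : R^o).
Proof.
move=> Fc; elim: r => [|i r IH] x.
  have -> : (fun x => \sum_(i <- [::]) F i x) = (fun=> 0) by apply/funext => y;
    rewrite big_nil.
  exact: cst_continuous.
have -> : (fun x => \sum_(i <- i :: r) F i x) = (fun x => F i x + \sum_(i <- r) F i x).
  by apply/funext => y; rewrite big_cons.
exact: (continuousD (Fc i x) (IH x)).
Qed.

Lemma continuous_deviation : continuous (deviation : space -> R^o).
Proof.
pose t k p q (x : space) : R^o :=
  `|complex.Re ((matrices_of x k - n%:R^-1%:M) p q)| +
  `|complex.Im ((matrices_of x k - n%:R^-1%:M) p q)|.
have tc k p q : continuous (t k p q).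
  move=> x; have [c1 c2] : ccont (fun x : space => (matrices_of x k - n%:R^-1%:M) p q).
    apply: (@eq_ccont (fun x : space => matrices_of x k p q + - (n%:R^-1%:M : 'M[K]_n)
      p q)).
      by move=> y; rewrite !mxE.
    by apply: ccontD; [exact: ccont_coord|exact: ccont_cst].
  have n1 := continuous_comp (c1 x) (@norm_continuous _ R^o _).
  have n2 := continuous_comp (c2 x) (@norm_continuous _ R^o _).
  exact: (continuousD n1 n2).
exact: (continuous_bigsum (fun k => continuous_bigsum (fun p => continuous_bigsum (tc k
  p)))).
Qed.

Lemma mxnorm1_le_deviation (x : space) k :
  mxnorm1 (matrices_of x k - n%:R^-1%:M) <= (deviation x)%:C.
Proof.
have row p q : 0 <= `|complex.Re ((matrices_of x k - n%:R^-1%:M) p q)| +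
    `|complex.Im ((matrices_of x k - n%:R^-1%:M) p q)| by rewrite addr_ge0.
apply: le_trans (_ : _ <= (\sum_p \sum_q (`|complex.Re ((matrices_of x k - n%:R^-1%:M)
  p q)| +
   `|complex.Im ((matrices_of x k - n%:R^-1%:M) p q)|))%:C) _.
  rewrite /mxnorm1 rmorph_sum /=; apply: ler_sum => p _.
  by rewrite rmorph_sum /=; apply: ler_sum => q _; exact: normc_le_ReIm.
rewrite lecR /deviation [leRHS](bigD1 k) //= lerDl.
by do 3 (apply: sumr_ge0 => ? _); rewrite addr_ge0.
Qed.

End Compactness.

Section Minimizers.
Import all_classical all_reals all_analysis.
Import numFieldNormedType.Exports.
Local Open Scope classical_set_scope.
Variables (R : realType) (n : nat).
Hypothesis n_gt0 : (0 < n)%N.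
Local Notation K := R[i].
Implicit Types (X : 'I_n -> 'M[K]_n) (C : 'M[K]_n).
Local Notation space := (prod_topology (fun _ : 'I_n * 'I_n * 'I_n * bool => R)).
Local Notation avg X := (fun _ : 'I_n => n%:R^-1 *: \sum_i X i).

Let ccont_total p q : ccont (fun x : space => (\sum_i matrices_of x i) p q).
Proof.
apply: (@eq_ccont _ _ (fun x : space => \sum_i matrices_of x i p q)).
  by move=> x; rewrite summxE.
by apply: ccont_sum => i; exact: ccont_coord.
Qed.

Let ccont_pdet_id : ccont (fun x : space => pdet (matrices_of x)).
Proof. by apply: ccont_pdet => i p q; exact: ccont_coord. Qed.

Let ccont_det_total : ccont (fun x : space => \det (\sum_i matrices_of x i)).
Proof.
have E (x : space) : n`!%:R^-1 * pdet (fun=> \sum_i matrices_of x i) = \det (\sum_i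
  matrices_of x i).
  by rewrite pdet_const mulKf // pnatr_eq0 -lt0n fact_gt0.
apply: (eq_ccont E); apply: ccontM; first exact: ccont_cst.
by apply: ccont_pdet => i p q; exact: ccont_total.
Qed.

(** Consider the tuples far from 1/n that do at least as well as the constant
    tuple with the same sum. On this compact set 1 - det (sum_i X_i) is
    positive: it can vanish only for sum_i X_i = 1, where the constant tuple
    is the only minimizer. So it has a positive lower bound. *)
Lemma near_of_small_pdet (r : R) : 0 < r ->
  exists2 mu : R, 0 < mu & forall X, density X ->
    complex.Re (1 - \det (\sum_i X i)) < mu -> pdet X <= pdet (avg X) ->
    forall k, mxnorm1 (X k - n%:R^-1%:M) <= r%:C.
Proof.
move=> r0.
pose D : set space := [set x | density (matrices_of x)] `&` [set x | r <= deviation x] `&`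
  [set x | 0 <= pdet (avg (matrices_of x)) - pdet (matrices_of x)].
have cD : closed D.
  apply: closedI; first apply: closedI.
  - exact: closed_density.
  - apply: (@closed_comp _ _ (@deviation R n : space -> R^o) [set y | r <= y]).
      by move=> x _; exact: continuous_deviation.
    exact: closed_ge.
  - apply: closed_ccont_ge0; apply: ccontD.
      apply: (@eq_ccont _ _ _ _ (fun x => esym (pdet_avg (matrices_of x)))).
      by apply: ccontM; [exact: ccont_cst|exact: ccont_det_total].
    apply: (@eq_ccont _ _ (fun x => -1 * pdet (matrices_of x))) => [x|];
      first by rewrite mulN1r.
    by apply: ccontM; [exact: ccont_cst|exact: ccont_pdet_id].
have pos x : D x -> 0 < complex.Re (1 - \det (\sum_i matrices_of x i)).
  move=> [[/= dx rx]]; rewrite subr_ge0 => px; have [le1 eq1] := det_total_le1 n_gt0 dx.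
  suff : 0 < 1 - \det (\sum_i matrices_of x i) by rewrite ltcE => /andP[].
  rewrite subr_gt0 lt_neqAle le1 andbT; apply/eqP => /eq1 sx.
  rewrite sx in px; have xE := identity_minimum dx sx px.
  move: rx; rewrite /deviation big1 ?leNgt ?r0 // => k _; rewrite big1 // => p _.
  by rewrite big1 // => q _; rewrite xE subrr mxE /= normr0 addr0.
have ex_mu : exists2 mu : R, 0 < mu &
    forall x, D x -> mu <= complex.Re (1 - \det (\sum_i matrices_of x i)).
  have [->|D0] := eqVneq D set0; first by exists 1.
  have hc : ccont (fun x : space => 1 - \det (\sum_i matrices_of x i)).
    apply: ccontD; first exact: ccont_cst.
    apply: (@eq_ccont _ _ (fun x : space => -1 * \det (\sum_i matrices_of x i))) => [x|];
      first by rewrite mulN1r.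
    by apply: ccontM; [exact: ccont_cst|exact: ccont_det_total].
  have /set0P D1 := D0; have DD : D `<=` [set x | density (matrices_of x)] by move=> x [[]].
  have [x Dx xmin] := density_EVT hc cD DD D1.
  by exists (complex.Re (1 - \det (\sum_i matrices_of x i))) => //; exact: pos.
have [mu mu0 muP] := ex_mu; exists mu => // X dX small px k.
have XE := coords_ofK X; set x := coords_of X in XE.
have totE : \sum_i matrices_of x i = \sum_i X i by apply: eq_bigr => i _; rewrite XE.
have dx : density (matrices_of x) by move=> i; rewrite XE; exact: dX.
have dev : deviation x < r.
  rewrite ltNge; apply/negP => rdev.
  have /muP : D x.
    split; first by split.
    by rewrite /= totE (eq_pdet XE) subr_ge0.
  by rewrite totE leNgt small.
rewrite -XE; apply: le_trans (mxnorm1_le_deviation x k) _.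
by rewrite lecR ltW.
Qed.

Lemma pdet_minimizer C : psd C -> \tr C = n%:R ->
  exists X, [/\ density X, \sum_i X i = C &
    forall Y, density Y -> \sum_i Y i = C -> pdet X <= pdet Y].
Proof.
move=> pC tC.
pose D : set space := [set x | density (matrices_of x)] `&`
  \bigcap_(pq in [set: 'I_n * 'I_n]) [set x | (\sum_i matrices_of x i) pq.1 pq.2 = C
    pq.1 pq.2].
have DE x : density (matrices_of x) -> \sum_i matrices_of x i = C -> D x.
  by move=> dx sx; split=> // pq _; rewrite /= sx.
have [|||x [dx sx] xmin] := density_EVT ccont_pdet_id (_ : closed D).
- apply: closedI; first exact: closed_density.
  apply: closed_bigI => pq _; apply: closed_ccont_eq; last exact: ccont_cst.
  exact: ccont_total.
- by move=> x [].
- have [dC sC] := density_scaled n_gt0 pC tC.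
  exists (coords_of (fun=> n%:R^-1 *: C)); apply: DE.
    by move=> i; rewrite coords_ofK; exact: dC.
  by rewrite (eq_bigr _ (fun i _ => coords_ofK _ i)) sC.
exists (matrices_of x); split=> //.
  by apply/matrixP => p q; exact: (sx (p, q) I).
move=> Y dY sY; have YE := coords_ofK Y.
have Dy : D (coords_of Y).
  apply: DE; first by move=> i; rewrite YE; exact: dY.
  by rewrite (eq_bigr _ (fun i _ => YE i)).
have := xmin _ Dy; rewrite /= (eq_pdet YE) (lecE (pdet (matrices_of x))) => ->.
have := density_pdet_ge0 dY; rewrite lecE => /andP[/eqP-> _].
have := density_pdet_ge0 dx; rewrite lecE => /andP[/eqP-> _].
by rewrite eqxx.
Qed.

End Minimizers.

Theorem theorem1p2 (R : realType) (n : nat) (n_gt0 : (0 < n)%N) :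
  exists2 eps : R, 0 < eps &
    forall (C : 'M[R[i]]_n) (c : 'rV[R]_n),
      psdmx C -> \tr C = n%:R -> eigenvalue_vector C c ->
      norm1 (c - const_mx 1) < eps ->
      uniquely_minimized_at (feasible C) (@mixed_discr R n)
        (fun _ : 'I_n => n%:R^-1 *: C).
Proof.
have [rho rho0 neg] := near_scalar_pair_negative R[i] n.
pose r := complex.Re rho.
have rE : r%:C = rho by rewrite RRe_real // gtr0_real.
have r0 : 0 < r by rewrite -ltcR rE.
have [mu mu0 muP] := near_of_small_pdet n_gt0 r0.
exists (Num.min 1 mu); first by rewrite lt_min ltr01.
move=> C c pC tC eC; rewrite lt_min => /andP[c1 cmu].
have detC : complex.Re (1 - \det C) < mu.
  rewrite (det_eigenvalues eC) /=.
  apply: le_lt_trans cmu; rewrite /norm1 lerBlDr -lerBlDl.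
  have -> : \sum_i `|(c - const_mx 1) 0 i| = \sum_i `|c 0 i - 1|.
    by apply: eq_bigr => i _; rewrite !mxE.
  apply: prod_ge_sum_dist; apply: ltW; apply: le_lt_trans c1.
  by rewrite /norm1; apply: ler_sum => i _; rewrite !mxE.
have nf0 : 0 < n`!%:R^-1 :> R[i] by rewrite invr_gt0 ltr0n fact_gt0.
have [dC sC] := density_scaled n_gt0 pC tC.
(* Averaging two distinct entries of a minimizer would decrease [pdet]. *)
have minimizer_equal X : density X -> \sum_i X i = C ->
    (forall Y, density Y -> \sum_i Y i = C -> pdet X <= pdet Y) ->
    X =1 fun=> n%:R^-1 *: C.
  move=> dX sX minX; rewrite -sX; apply: (all_equal_scaled n_gt0) => i j.
  apply/eqP; apply: contraT => Xij.
  have near : forall k, mxnorm1 (X k - n%:R^-1%:M) <= rho.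
    by rewrite -rE; apply: (muP X dX); rewrite sX; [exact: detC|exact: minX].
  have [Y [dY sY lt_Y]] := average_lt neg dX near Xij.
  by have := minX Y dY (etrans sY sX); rewrite (lt_geF lt_Y).
have [X [dX sX minX]] := pdet_minimizer n_gt0 pC tC.
have XE := minimizer_equal X dX sX minX.
have minC Y : density Y -> \sum_i Y i = C -> pdet (fun _ : 'I_n => n%:R^-1 *: C) <= pdet Y.
  by rewrite -(eq_pdet XE); exact: minX.
split.
- exact: (proj2 (feasibleE _ _) (conj dC sC)).
- move=> Y /feasibleE[dY sY]; rewrite !mixed_discrE (ler_pM2l nf0).
  exact: (minC Y dY sY).
move=> Y /feasibleE[dY sY]; rewrite !mixed_discrE => /(mulfI (lt0r_neq0 nf0)) YE.
apply: (minimizer_equal Y dY sY) => Z dZ sZ; rewrite YE.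
exact: (minC Z dZ sZ).
Qed.
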